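(* Let $\mathbf S$ be a category with finite products and let $\mathscr C$ be an $\mathbf S$-indexed symmetric monoidal category with indexed homotopy coproducts preserved by $\otimes$. Let $A\in\mathbf S$, let $M\in\mathscr C^A$ be fiberwise dualizable, and let $f\colon M\to M$ be any endomorphism in $\mathscr C^A$. Then the symmetric monoidal trace $\mathrm{tr}(f)\colon I_A\to I_A$ in $\mathscr C^A$ is equal to the composite $$I_A\longrightarrow (\pi_A)^*(\pi_A)_!(\Delta_A)^*(\Delta_A)_!I_A=(\pi_A)^*\langle\langle A\rangle\rangle\xrightarrow{(\pi_A)^*\mathrm{tr}(\widehat f)}(\pi_A)^*I_\star\cong I_A,$$ where the first morphism is induced by the units of the adjunctions $(\pi_A)_!\dashv(\pi_A)^*$ and $(\Delta_A)_!\dashv(\Delta_A)^*$, and $\mathrm{tr}(\widehat f)\colon\langle\langle A\rangle\rangle\to I_\star$ is the bicategorical trace of $\widehat f\colon\widehat M\to\widehat M$ in $\mathscr C/_{\mathbf S}$.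
   Context: **Indexed categories.** $\star$ is the terminal object of $\mathbf S$, $\pi_A\colon A\to\star$ the unique map and $\Delta_A\colon A\to A\times A$ the diagonal; canonical isomorphisms such as $A\times\star\cong A$ are suppressed. An $\mathbf S$-indexed symmetric monoidal category $\mathscr C$ is a pseudofunctor from $\mathbf S^{\mathrm{op}}$ to the 2-category of symmetric monoidal categories, strong symmetric monoidal functors and monoidal natural transformations; its value at $A$ is $(\mathscr C^A,\otimes_A,I_A)$ and its value at $f\colon A\to B$ is the reindexing functor $f^*\colon\mathscr C^B\to\mathscr C^A$. For $M\in\mathscr C^A$, $N\in\mathscr C^B$ the external product is $M\boxtimes N=(\mathrm{id}_A\times\pi_B)^*M\otimes_{A\times B}(\pi_A\times\mathrm{id}_B)^*N\in\mathscr C^{A\times B}$, and $U=I_\star$. There are canonical isomorphisms $M\otimes_AN\cong\Delta_A^*(M\boxtimes N)$, $I_A\cong\pi_A^*U$, $f^*M\boxtimes g^*N\cong(f\times g)^*(M\boxtimes N)$. **Indexed homotopy coproducts preserved by $\otimes$** means: each $f^*$ has a left adjoint $f_!$; for each square in a class of commutative squares of $\mathbf S$ called homotopy pullback squares, with top $f\colon A\to B$, left $h\colon A\to C$, right $g\colon B\to D$, bottom $k\colon C\to D$, the Beck-Chevalley morphism $f_!h^*\to f_!h^*k^*k_!\cong f_!f^*g^*k_!\to g^*k_!$ is an isomorphism; and for $f\colon A\to B$, $M\in\mathscr C^B$, $N\in\mathscr C^A$ the canonical map $f_!(f^*M\otimes N)\to f_!(f^*M\otimes f^*f_!N)\cong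 f_!f^*(M\otimes f_!N)\to M\otimes f_!N$ is an isomorphism (equivalently, the canonical maps $(f\times g)_!(M\boxtimes N)\to f_!M\boxtimes g_!N$ are isomorphisms). The class of homotopy pullback squares depends on the situation; it is only assumed to contain the following squares, their transposes, and all squares obtained from these by cartesian product with a fixed object: (a) top $f\times\mathrm{id}_C\colon A\times C\to B\times C$, left $\mathrm{id}_A\times g\colon A\times C\to A\times D$, right $\mathrm{id}_B\times g$, bottom $f\times\mathrm{id}_D$; (b) top and left $\Delta_A\colon A\to A\times A$, right $\mathrm{id}_A\times\Delta_A$, bottom $\Delta_A\times\mathrm{id}_A\colon A\times A\to A\times A\times A$; (c) for $f\colon A\to B$: top $(\mathrm{id}_A,f)\colon A\to A\times B$, left $f\colon A\to B$, right $f\times\mathrm{id}_B$, bottom $\Delta_B$. The square with top and left $\mathrm{id}_A$ and right and bottom $\Delta_A$ is not assumed to belong to it. **The bicategory $\mathscr C/_{\mathbf S}$** has the objects of $\mathbf S$ as 0-cells and hom-categories $\mathscr C/_{\mathbf S}(A,B)=\mathscr C^{A\times B}$. For 1-cells $M\colon A\to B$, $N\colon B\to C$, $M\odot N=(\mathrm{id}_A\times\pi_B\times\mathrm{id}_C)_!(\mathrm{id}_A\times\Delta_B\times\mathrm{id}_C)^*(M\boxtimes N)\colon A\to C$; units are $U_A=(\Delta_A)_!\pi_A^*U\cong(\Delta_A)_!I_A$. The associator identifies both bracketings of a triple composite, via pseudofunctoriality, compatibility of $\boxtimes$ with reindexing and pushforward, and Beck-Chevalley for (a), with $(\mathrm{id}_A\times\pi_B\times\pi_C\times\mathrm{id}_D)_!(\mathrm{id}_A\times\Delta_B\times\Delta_C\times\mathrm{id}_D)^*(M\boxtimes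 N\boxtimes P)$. The right unitor is $M\odot U_B\cong(\mathrm{id}_A\times\pi_B\times\mathrm{id}_B)_!(\mathrm{id}_A\times\Delta_B)_!(\mathrm{id}_A\times\Delta_B)^*(\mathrm{id}_A\times\mathrm{id}_B\times\pi_B)^*(M\boxtimes U)\cong M$, by Beck-Chevalley for (b) and $(\pi\times\mathrm{id})\Delta=\mathrm{id}=(\mathrm{id}\times\pi)\Delta$; the left unitor is analogous. **Shadow.** $\langle\langle M\rangle\rangle=(\pi_A)_!(\Delta_A)^*M\in\mathscr C^\star$ for $M\colon A\to A$, and $\langle\langle A\rangle\rangle:=\langle\langle U_A\rangle\rangle=(\pi_A)_!(\Delta_A)^*(\Delta_A)_!I_A$. For $M\colon A\to B$, $N\colon B\to A$ the isomorphism $\theta\colon\langle\langle M\odot N\rangle\rangle\cong\langle\langle N\odot M\rangle\rangle$ identifies the two sides (by Beck-Chevalley for (a)) with $(\pi_{A\times B})_!\delta^*(M\boxtimes N)$ and $(\pi_{A\times B})_!\delta'^*(N\boxtimes M)$, where $\delta(a,b)=(a,b,b,a)$ and $\delta'(a,b)=(b,a,a,b)$, and then uses the isomorphism $M\boxtimes N\cong\gamma^*(N\boxtimes M)$ given by the symmetry of $\otimes$ ($\gamma$ the swap). On $\mathscr C/_{\mathbf S}(\star,\star)\simeq\mathscr C^\star$, $\odot$ is $\otimes$ and the shadow is the identity, up to canonical isomorphism. **Duality and trace.** An object $M$ of a symmetric monoidal category is dualizable if there are $M^\bigstar$, $\eta\colon I\to M\otimes M^\bigstar$, $\epsilon\colon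 M^\bigstar\otimes M\to I$ satisfying the triangle identities; the trace of $f\colon Q\otimes M\to M\otimes P$ is $Q\xrightarrow{\mathrm{id}\otimes\eta}Q\otimes M\otimes M^\bigstar\xrightarrow{f\otimes\mathrm{id}}M\otimes P\otimes M^\bigstar\cong M^\bigstar\otimes M\otimes P\xrightarrow{\epsilon\otimes\mathrm{id}}P$. A 1-cell $M\colon R\to S$ of a bicategory is right dualizable if there are $M^\bigstar\colon S\to R$, $\eta\colon U_R\to M\odot M^\bigstar$, $\epsilon\colon M^\bigstar\odot M\to U_S$ satisfying the triangle identities; the trace of $f\colon Q\odot M\to M\odot P$ is $\langle\langle Q\rangle\rangle\to\langle\langle Q\odot M\odot M^\bigstar\rangle\rangle\to\langle\langle M\odot P\odot M^\bigstar\rangle\rangle\xrightarrow{\theta}\langle\langle M^\bigstar\odot M\odot P\rangle\rangle\to\langle\langle P\rangle\rangle$, using $\eta,f,\theta,\epsilon$ in turn. For a plain endomorphism, $Q$ and $P$ are units, inserted via unit isomorphisms. **Fiberwise duality.** $M\in\mathscr C^A$ is fiberwise dualizable if it is dualizable in the symmetric monoidal category $\mathscr C^A$. $\widehat M\colon A\to\star$ denotes $M$ regarded as a 1-cell of $\mathscr C/_{\mathbf S}$ via $A\cong A\times\star$, and $\widehat f$ the corresponding 2-cell; when $M$ is fiberwise dualizable, $\widehat M$ is right dualizable. *)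

(* Defs.v *)
Set Implicit Arguments.
Unset Strict Implicit.
Unset Printing Implicit Defensive.

(** * Categories and functors *)

Record Category := {
  ob :> Type;
  hom : ob -> ob -> Type;
  idm : forall x, hom x x;
  comp : forall x y z, hom y z -> hom x y -> hom x z;
  comp_idl : forall x y (f : hom x y), comp (idm y) f = f;
  comp_idr : forall x y (f : hom x y), comp f (idm x) = f;
  comp_assoc : forall w x y z (h : hom y z) (g : hom x y) (f : hom w x),
    comp h (comp g f) = comp (comp h g) f
}.

Arguments hom {c} x y : rename.
Arguments idm {c} x : rename.
Arguments comp {c x y z} g f : rename.

Notation "x ⟶ y" := (hom x y) (at level 70, no associativity).
Notation "g ∘ f" := (comp g f) (at level 40, left associativity).

Record IsIso (C : Category) (x y : C) (f : x ⟶ y) := {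
  inverse : y ⟶ x;
  inverse_r : f ∘ inverse = idm y;
  inverse_l : inverse ∘ f = idm x
}.

Record Iso (C : Category) (x y : C) := {
  fwd :> x ⟶ y;
  bwd : y ⟶ x;
  fwd_bwd : fwd ∘ bwd = idm y;
  bwd_fwd : bwd ∘ fwd = idm x
}.

Definition iso_of (C : Category) (x y : C) (f : x ⟶ y) (H : IsIso f) : Iso x y :=
  {| fwd := f; bwd := inverse H; fwd_bwd := inverse_r H; bwd_fwd := inverse_l H |}.

Definition iso_id (C : Category) (x : C) : Iso x x :=
  {| fwd := idm x; bwd := idm x;
     fwd_bwd := comp_idl (idm x); bwd_fwd := comp_idl (idm x) |}.

Definition inv (C : Category) (x y : C) (i : Iso x y) : Iso y x :=
  {| fwd := bwd i; bwd := fwd i; fwd_bwd := bwd_fwd i; bwd_fwd := fwd_bwd i |}.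

Lemma cancel_mid (C : Category) (w x y z : C)
    (j : y ⟶ z) (i : x ⟶ y) (i' : y ⟶ x) (j' : w ⟶ y) :
  i ∘ i' = idm y -> (j ∘ i) ∘ (i' ∘ j') = j ∘ j'.
Proof.
  intros H.
  now rewrite <- comp_assoc, (comp_assoc i), H, comp_idl.
Qed.

Definition iso_comp (C : Category) (x y z : C) (i : Iso x y) (j : Iso y z) : Iso x z.
Proof.
  refine {| fwd := fwd j ∘ fwd i; bwd := bwd i ∘ bwd j |}.
  - rewrite cancel_mid by apply fwd_bwd. apply fwd_bwd.
  - rewrite cancel_mid by apply bwd_fwd. apply bwd_fwd.
Defined.

(* Composition of isomorphisms is written in diagrammatic order. *)
Notation "i ;; j" := (iso_comp i j) (at level 60, right associativity).

Definition eq_iso (C : Category) (x y : C) (e : x = y) : Iso x y :=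
  match e in _ = z return Iso x z with eq_refl => iso_id x end.

Record Functor (C D : Category) := {
  fobj :> C -> D;
  fmap : forall x y, x ⟶ y -> fobj x ⟶ fobj y;
  fmap_id : forall x, fmap (idm x) = idm (fobj x);
  fmap_comp : forall x y z (g : y ⟶ z) (f : x ⟶ y), fmap (g ∘ f) = fmap g ∘ fmap f
}.

Arguments fmap {C D} F {x y} f : rename.

Definition fmap_iso (C D : Category) (F : Functor C D) (x y : C) (i : Iso x y) :
  Iso (F x) (F y).
Proof.
  refine {| fwd := fmap F (fwd i); bwd := fmap F (bwd i) |}.
  - now rewrite <- fmap_comp, fwd_bwd, fmap_id.
  - now rewrite <- fmap_comp, bwd_fwd, fmap_id.
Defined.

Definition functor_id (C : Category) : Functor C C :=
  {| fobj := fun x => x; fmap := fun x y f => f;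
     fmap_id := fun x => eq_refl; fmap_comp := fun x y z g f => eq_refl |}.

Definition functor_comp (C D E : Category) (F : Functor C D) (G : Functor D E) :
  Functor C E.
Proof.
  refine {| fobj := fun x => G (F x); fmap := fun x y f => fmap G (fmap F f) |}.
  - intros x. now rewrite !fmap_id.
  - intros x y z g f. now rewrite !fmap_comp.
Defined.

(** * Adjunctions *)

Record LeftAdjoint (C D : Category) (G : Functor D C) := {
  ladj :> Functor C D;
  adj_unit : forall x : C, x ⟶ G (ladj x);
  adj_counit : forall y : D, ladj (G y) ⟶ y;
  adj_unit_nat : forall (x x' : C) (f : x ⟶ x'),
    adj_unit x' ∘ f = fmap G (fmap ladj f) ∘ adj_unit x;
  adj_counit_nat : forall (y y' : D) (g : y ⟶ y'),
    adj_counit y' ∘ fmap ladj (fmap G g) = g ∘ adj_counit y;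
  adj_triangle_l : forall x : C,
    adj_counit (ladj x) ∘ fmap ladj (adj_unit x) = idm (ladj x);
  adj_triangle_r : forall y : D,
    fmap G (adj_counit y) ∘ adj_unit (G y) = idm (G y)
}.

Arguments adj_unit {C D G} L x : rename.
Arguments adj_counit {C D G} L y : rename.

Section Adjunctions.
Context {C D : Category}.

Definition transpose {G : Functor D C} (L : LeftAdjoint G) {x : C} {y : D}
    (g : x ⟶ G y) : L x ⟶ y :=
  adj_counit L y ∘ fmap L g.

Lemma transpose_unit (G : Functor D C) (L : LeftAdjoint G) x y (g : x ⟶ G y) :
  fmap G (transpose L g) ∘ adj_unit L x = g.
Proof.
  unfold transpose.
  now rewrite fmap_comp, <- comp_assoc, <- adj_unit_nat, comp_assoc,
    adj_triangle_r, comp_idl.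
Qed.

Lemma adj_ext (G : Functor D C) (L : LeftAdjoint G) x y (h k : L x ⟶ y) :
  fmap G h ∘ adj_unit L x = fmap G k ∘ adj_unit L x -> h = k.
Proof.
  intros H.
  assert (E : forall l : L x ⟶ y, l = transpose L (fmap G l ∘ adj_unit L x)).
  { intros l. unfold transpose.
    now rewrite fmap_comp, comp_assoc, adj_counit_nat, <- comp_assoc,
      adj_triangle_l, comp_idr. }
  now rewrite (E h), (E k), H.
Qed.

Definition adj_id : LeftAdjoint (functor_id C).
Proof.
  refine (@Build_LeftAdjoint C C (functor_id C) (functor_id C)
            (fun x => idm x) (fun x => idm x) _ _ _ _); simpl; intros;
  now rewrite ?comp_idl, ?comp_idr.
Defined.

Definition adj_comp {E : Category} {F : Functor E D} {G : Functor D C}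
    (L : LeftAdjoint G) (K : LeftAdjoint F) : LeftAdjoint (functor_comp F G).
Proof.
  refine (@Build_LeftAdjoint C E (functor_comp F G) (functor_comp L K)
            (fun x => fmap G (adj_unit K (L x)) ∘ adj_unit L x)
            (fun y => adj_counit K y ∘ fmap K (adj_counit L (F y))) _ _ _ _);
  simpl; intros.
  - now rewrite <- comp_assoc, adj_unit_nat, !comp_assoc, <- !fmap_comp, adj_unit_nat.
  - now rewrite <- comp_assoc, <- fmap_comp, adj_counit_nat, fmap_comp, !comp_assoc,
      adj_counit_nat.
  - rewrite <- comp_assoc, <- fmap_comp, (fmap_comp L), (comp_assoc (adj_counit L _)).
    now rewrite adj_counit_nat, <- comp_assoc, adj_triangle_l, comp_idr,
      adj_triangle_l.
  - rewrite (fmap_comp F), !(fmap_comp G), comp_assoc.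
    rewrite <- (comp_assoc _ (fmap G (fmap F (fmap K _)))), <- (fmap_comp G).
    rewrite <- adj_unit_nat, (fmap_comp G), comp_assoc, <- (fmap_comp G).
    now rewrite adj_triangle_r, fmap_id, comp_idl, adj_triangle_r.
Defined.

Definition adj_unique {G G' : Functor D C} (L : LeftAdjoint G) (L' : LeftAdjoint G')
    (t : forall y, Iso (G y) (G' y))
    (t_nat : forall y y' (f : y ⟶ y'), t y' ∘ fmap G f = fmap G' f ∘ t y) (x : C) :
  Iso (L x) (L' x).
Proof.
  assert (t_nat' : forall y y' (f : y ⟶ y'),
             bwd (t y') ∘ fmap G' f = fmap G f ∘ bwd (t y)).
  { intros y y' f.
    rewrite <- (comp_idr (fmap G' f)), <- (fwd_bwd (t y)), (comp_assoc (fmap G' f)).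
    now rewrite <- t_nat, !comp_assoc, bwd_fwd, comp_idl. }
  refine {| fwd := transpose L (bwd (t (L' x)) ∘ adj_unit L' x);
            bwd := transpose L' (fwd (t (L x)) ∘ adj_unit L x) |}.
  - apply adj_ext.
    rewrite fmap_comp, <- comp_assoc, transpose_unit, comp_assoc, <- t_nat.
    now rewrite <- comp_assoc, transpose_unit, comp_assoc, fwd_bwd, fmap_id.
  - apply adj_ext.
    rewrite fmap_comp, <- comp_assoc, transpose_unit, comp_assoc, <- t_nat'.
    now rewrite <- comp_assoc, transpose_unit, comp_assoc, bwd_fwd, fmap_id.
Defined.

Definition adj_unit_isiso {G : Functor D C} (L : LeftAdjoint G) (K : Functor C D)
    (s : forall y, Iso (K (G y)) y) (t : forall x, Iso (G (K x)) x)
    (s_nat : forall y y' (f : y ⟶ y'), s y' ∘ fmap K (fmap G f) = f ∘ s y)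
    (t_nat : forall x x' (f : x ⟶ x'), t x' ∘ fmap G (fmap K f) = f ∘ t x) (x : C) :
  IsIso (adj_unit L x).
Proof.
  assert (s_conj : forall y y' (f : y ⟶ y'),
             fmap K (fmap G f) = bwd (s y') ∘ (f ∘ s y)).
  { intros y y' f. now rewrite <- s_nat, comp_assoc, bwd_fwd, comp_idl. }
  assert (K_faithful : forall x x' (f g : x ⟶ x'), fmap K f = fmap K g -> f = g).
  { intros z z' f g H.
    rewrite <- (comp_idr f), <- (comp_idr g), <- (fwd_bwd (t z)), !comp_assoc.
    now rewrite <- !t_nat, H. }
  assert (G_full : forall y y' (h : G y ⟶ G y'), exists f : y ⟶ y', fmap G f = h).
  { intros y y' h. exists (s y' ∘ fmap K h ∘ bwd (s y)). apply K_faithful.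
    rewrite s_conj, <- !comp_assoc, bwd_fwd, comp_idr.
    now rewrite comp_assoc, bwd_fwd, comp_idl. }
  assert (H : (t x ∘ fmap G (transpose L (bwd (t x)))) ∘ adj_unit L x = idm x).
  { now rewrite <- comp_assoc, transpose_unit, fwd_bwd. }
  refine {| inverse := t x ∘ fmap G (transpose L (bwd (t x))); inverse_l := H |}.
  destruct (G_full _ _ (adj_unit L x ∘ (t x ∘ fmap G (transpose L (bwd (t x))))))
    as [w Hw].
  rewrite <- Hw, <- fmap_id. f_equal. apply (adj_ext (L := L)).
  now rewrite Hw, <- comp_assoc, H, comp_idr, fmap_id, comp_idl.
Defined.

End Adjunctions.

(** * Symmetric monoidal categories *)

Reserved Notation "x ⊗ y" (at level 38, right associativity).
Reserved Notation "f ⊗₁ g" (at level 38, right associativity).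

Record SymMonCat := {
  smc_cat :> Category;
  tens : smc_cat -> smc_cat -> smc_cat
    where "x ⊗ y" := (tens x y);
  tmap : forall x x' y y' : smc_cat, x ⟶ x' -> y ⟶ y' -> x ⊗ y ⟶ x' ⊗ y'
    where "f ⊗₁ g" := (tmap f g);
  munit : smc_cat;
  assoc : forall x y z, Iso ((x ⊗ y) ⊗ z) (x ⊗ (y ⊗ z));
  lunit : forall x, Iso (munit ⊗ x) x;
  runit : forall x, Iso (x ⊗ munit) x;
  braid : forall x y, x ⊗ y ⟶ y ⊗ x;
  tmap_id : forall x y, idm x ⊗₁ idm y = idm (x ⊗ y);
  tmap_comp : forall x x' x'' y y' y''
      (f' : x' ⟶ x'') (f : x ⟶ x') (g' : y' ⟶ y'') (g : y ⟶ y'),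
    (f' ∘ f) ⊗₁ (g' ∘ g) = (f' ⊗₁ g') ∘ (f ⊗₁ g);
  assoc_nat : forall x x' y y' z z' (f : x ⟶ x') (g : y ⟶ y') (h : z ⟶ z'),
    assoc x' y' z' ∘ ((f ⊗₁ g) ⊗₁ h) = (f ⊗₁ (g ⊗₁ h)) ∘ assoc x y z;
  lunit_nat : forall x x' (f : x ⟶ x'), lunit x' ∘ (idm munit ⊗₁ f) = f ∘ lunit x;
  runit_nat : forall x x' (f : x ⟶ x'), runit x' ∘ (f ⊗₁ idm munit) = f ∘ runit x;
  braid_nat : forall x x' y y' (f : x ⟶ x') (g : y ⟶ y'),
    braid x' y' ∘ (f ⊗₁ g) = (g ⊗₁ f) ∘ braid x y;
  triangle : forall x y,
    (idm x ⊗₁ lunit y) ∘ assoc x munit y = runit x ⊗₁ idm y;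
  pentagon : forall w x y z,
    assoc w x (y ⊗ z) ∘ assoc (w ⊗ x) y z
    = (idm w ⊗₁ assoc x y z) ∘ assoc w (x ⊗ y) z ∘ (assoc w x y ⊗₁ idm z);
  hexagon : forall x y z,
    assoc y z x ∘ braid x (y ⊗ z) ∘ assoc x y z
    = (idm y ⊗₁ braid x z) ∘ assoc y x z ∘ (braid x y ⊗₁ idm z);
  braid_braid : forall x y, braid y x ∘ braid x y = idm (x ⊗ y)
}.

Notation "x ⊗ y" := (tens x y).
Notation "f ⊗₁ g" := (tmap f g).

Arguments munit {s} : rename.
Arguments assoc {s} x y z : rename.
Arguments lunit {s} x : rename.
Arguments runit {s} x : rename.
Arguments braid {s} x y : rename.

Definition tens_iso (V : SymMonCat) (x x' y y' : V) (i : Iso x x') (j : Iso y y') :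
  Iso (x ⊗ y) (x' ⊗ y').
Proof.
  refine {| fwd := fwd i ⊗₁ fwd j; bwd := bwd i ⊗₁ bwd j |}.
  - now rewrite <- tmap_comp, !fwd_bwd, tmap_id.
  - now rewrite <- tmap_comp, !bwd_fwd, tmap_id.
Defined.

Definition braid_iso (V : SymMonCat) (x y : V) : Iso (x ⊗ y) (y ⊗ x) :=
  {| fwd := braid x y; bwd := braid y x;
     fwd_bwd := braid_braid y x; bwd_fwd := braid_braid x y |}.

(* Strong symmetric monoidal functors. *)
Record SMFunctor (V W : SymMonCat) := {
  smf_functor :> Functor V W;
  smf_mu : forall x y : V, Iso (smf_functor x ⊗ smf_functor y) (smf_functor (x ⊗ y));
  smf_eps : Iso munit (smf_functor munit);
  smf_mu_nat : forall (x x' y y' : V) (f : x ⟶ x') (g : y ⟶ y'),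
    smf_mu x' y' ∘ (fmap smf_functor f ⊗₁ fmap smf_functor g)
    = fmap smf_functor (f ⊗₁ g) ∘ smf_mu x y;
  smf_assoc : forall x y z : V,
    fmap smf_functor (assoc x y z) ∘ smf_mu (x ⊗ y) z ∘ (smf_mu x y ⊗₁ idm _)
    = smf_mu x (y ⊗ z) ∘ (idm _ ⊗₁ smf_mu y z) ∘ assoc _ _ _;
  smf_lunit : forall x : V,
    fmap smf_functor (lunit x) ∘ smf_mu munit x ∘ (smf_eps ⊗₁ idm _) = lunit _;
  smf_runit : forall x : V,
    fmap smf_functor (runit x) ∘ smf_mu x munit ∘ (idm _ ⊗₁ smf_eps) = runit _;
  smf_braid : forall x y : V,
    fmap smf_functor (braid x y) ∘ smf_mu x y = smf_mu y x ∘ braid _ _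
}.

Arguments smf_mu {V W} F x y : rename.
Arguments smf_eps {V W} F : rename.

Definition smf_id (V : SymMonCat) : SMFunctor V V.
Proof.
  refine {| smf_functor := functor_id V;
            smf_mu := fun x y => iso_id (x ⊗ y : V);
            smf_eps := iso_id munit |}; simpl; intros;
  now rewrite ?tmap_id, ?comp_idl, ?comp_idr.
Defined.

(* [smf_comp F G] is the composite "first F, then G". *)
Definition smf_comp (V W X : SymMonCat) (F : SMFunctor V W) (G : SMFunctor W X) :
  SMFunctor V X.
Proof.
  refine {| smf_functor := functor_comp F G;
            smf_mu := fun x y => smf_mu G (F x) (F y) ;; fmap_iso G (smf_mu F x y);
            smf_eps := smf_eps G ;; fmap_iso G (smf_eps F) |}; simpl; intros.
  - now rewrite <- comp_assoc, smf_mu_nat, !comp_assoc, <- !fmap_comp, smf_mu_nat.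
  - rewrite <- (comp_idl (idm (G (F z)))), <- (fmap_id G (F z)), tmap_comp.
    rewrite <- (comp_idl (idm (G (F x)))), <- (fmap_id G (F x)), tmap_comp.
    rewrite !fmap_id.
    rewrite <- (fmap_id G (F z)), <- (fmap_id G (F x)).
    rewrite !comp_assoc.
    rewrite <- (comp_assoc _ (smf_mu G (F (x ⊗ y)) (F z)) (fmap G _ ⊗₁ _)).
    rewrite smf_mu_nat, !comp_assoc, <- !fmap_comp, smf_assoc.
    rewrite <- (comp_assoc _ (smf_mu G (F x) (F (y ⊗ z)))), smf_mu_nat.
    rewrite !comp_assoc, <- !fmap_comp.
    rewrite !(fmap_comp G (smf_mu F x (y ⊗ z) ∘ _)), !fmap_id.
    rewrite <- !comp_assoc. f_equal. rewrite !comp_assoc. apply smf_assoc.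
  - rewrite <- (comp_idl (idm (G (F x)))), tmap_comp, <- (fmap_id G (F x)).
    rewrite !comp_assoc, <- (comp_assoc _ (smf_mu G _ _) (fmap G _ ⊗₁ _)).
    rewrite smf_mu_nat, !comp_assoc, <- !fmap_comp, smf_lunit, fmap_id.
    apply smf_lunit.
  - rewrite <- (comp_idl (idm (G (F x)))), tmap_comp, <- (fmap_id G (F x)).
    rewrite !comp_assoc, <- (comp_assoc _ (smf_mu G _ _) (_ ⊗₁ fmap G _)).
    rewrite smf_mu_nat, !comp_assoc, <- !fmap_comp, smf_runit, fmap_id.
    apply smf_runit.
  - now rewrite comp_assoc, <- fmap_comp, smf_braid, fmap_comp, <- !comp_assoc,
      smf_braid.
Defined.

(* Invertible monoidal natural transformations. *)
Record MonNatIso (V W : SymMonCat) (F G : SMFunctor V W) := {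
  mni :> forall x : V, Iso (F x) (G x);
  mni_nat : forall (x y : V) (f : x ⟶ y), mni y ∘ fmap F f = fmap G f ∘ mni x;
  mni_mu : forall x y : V, mni (x ⊗ y) ∘ smf_mu F x y = smf_mu G x y ∘ (mni x ⊗₁ mni y);
  mni_eps : mni munit ∘ smf_eps F = smf_eps G
}.

(** ** Duality and trace in a symmetric monoidal category *)

Section SymmetricMonoidalTrace.
Context {V : SymMonCat}.

Record Dual (M : V) := {
  dual : V;
  coev : munit ⟶ M ⊗ dual;
  ev : dual ⊗ M ⟶ munit;
  dual_triangle_l :
    runit M ∘ (idm M ⊗₁ ev) ∘ assoc M dual M ∘ (coev ⊗₁ idm M) ∘ inv (lunit M)
    = idm M;
  dual_triangle_r :
    lunit dual ∘ (ev ⊗₁ idm dual) ∘ inv (assoc dual M dual) ∘ (idm dual ⊗₁ coev)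
      ∘ inv (runit dual)
    = idm dual
}.

Definition sm_trace {M : V} (D : Dual M) {Q P : V} (f : Q ⊗ M ⟶ M ⊗ P) : Q ⟶ P :=
  lunit P
  ∘ (ev D ⊗₁ idm P)
  ∘ inv (assoc (dual D) M P)
  ∘ braid (M ⊗ P) (dual D)
  ∘ (f ⊗₁ idm (dual D))
  ∘ inv (assoc Q M (dual D))
  ∘ (idm Q ⊗₁ coev D)
  ∘ inv (runit Q).

Definition sm_endo_trace {M : V} (D : Dual M) (f : M ⟶ M) : (munit : V) ⟶ munit :=
  sm_trace D (inv (runit M) ∘ f ∘ lunit M).

End SymmetricMonoidalTrace.

(** * Finite products *)

Reserved Notation "A × B" (at level 36, left associativity).
Reserved Notation "⟨ f , g ⟩" (at level 0, format "⟨ f ,  g ⟩").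

Record FiniteProducts (S : Category) := {
  star : S;
  bang : forall A : S, A ⟶ star;
  bang_unique : forall (A : S) (f g : A ⟶ star), f = g;
  prod : S -> S -> S
    where "A × B" := (prod A B);
  fst : forall A B : S, A × B ⟶ A;
  snd : forall A B : S, A × B ⟶ B;
  pair : forall X A B : S, X ⟶ A -> X ⟶ B -> X ⟶ A × B
    where "⟨ f , g ⟩" := (pair f g);
  fst_pair : forall (X A B : S) (f : X ⟶ A) (g : X ⟶ B), fst A B ∘ ⟨f, g⟩ = f;
  snd_pair : forall (X A B : S) (f : X ⟶ A) (g : X ⟶ B), snd A B ∘ ⟨f, g⟩ = g;
  pair_ext : forall (X A B : S) (h k : X ⟶ A × B),
    fst A B ∘ h = fst A B ∘ k -> snd A B ∘ h = snd A B ∘ k -> h = k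
}.

(** * Indexed symmetric monoidal categories *)

Record IndexedSMC (S : Category) := {
  fib : S -> SymMonCat;
  reidx : forall A B : S, A ⟶ B -> SMFunctor (fib B) (fib A);
  reidx_id : forall A : S, MonNatIso (smf_id (fib A)) (reidx (idm A));
  reidx_comp : forall (A B C : S) (f : A ⟶ B) (g : B ⟶ C),
    MonNatIso (smf_comp (reidx g) (reidx f)) (reidx (g ∘ f));
  reidx_unit_l : forall (A B : S) (f : A ⟶ B) (M : fib B),
    eq_iso (f_equal (fun h => reidx h M) (comp_idl f))
      ∘ reidx_comp f (idm B) M ∘ fmap (reidx f) (reidx_id B M)
    = idm (reidx f M);
  reidx_unit_r : forall (A B : S) (f : A ⟶ B) (M : fib B),
    eq_iso (f_equal (fun h => reidx h M) (comp_idr f))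
      ∘ reidx_comp (idm A) f M ∘ reidx_id A (reidx f M)
    = idm (reidx f M);
  reidx_assoc : forall (A B C D : S) (f : A ⟶ B) (g : B ⟶ C) (h : C ⟶ D) (M : fib D),
    reidx_comp f (h ∘ g) M ∘ fmap (reidx f) (reidx_comp g h M)
    = eq_iso (f_equal (fun k => reidx k M) (comp_assoc h g f))
      ∘ reidx_comp (g ∘ f) h M ∘ reidx_comp f g (reidx h M)
}.

Arguments reidx {S} C {A B} f : rename.
Arguments reidx_id {S} C A : rename.
Arguments reidx_comp {S} C {A B D} f g : rename.

Section Reindexing.
Context {S : Category} {C : IndexedSMC S}.
Local Notation "f ^*" := (reidx C f) (at level 2, left associativity, format "f ^*").

Definition reidx_eq {A B : S} {f g : A ⟶ B} (e : f = g) (M : fib C B) :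
  Iso (f^* M) (g^* M) :=
  eq_iso (f_equal (fun h => h^* M) e).

Definition reidx_tri {A B D : S} {f : A ⟶ B} {g : B ⟶ D} {h : A ⟶ D}
    (e : g ∘ f = h) (M : fib C D) : Iso (f^* (g^* M)) (h^* M) :=
  reidx_comp C f g M ;; reidx_eq e M.

Definition reidx_sq {A B B' D : S} {f : A ⟶ B} {g : B ⟶ D} {h : A ⟶ B'} {k : B' ⟶ D}
    (e : g ∘ f = k ∘ h) (M : fib C D) : Iso (f^* (g^* M)) (h^* (k^* M)) :=
  reidx_tri e M ;; inv (reidx_comp C h k M).

Lemma reidx_eq_nat {A B : S} {f g : A ⟶ B} (e : f = g) {M N : fib C B} (u : M ⟶ N) :
  reidx_eq e N ∘ fmap (f^*) u = fmap (g^*) u ∘ reidx_eq e M.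
Proof. destruct e. simpl. now rewrite comp_idl, comp_idr. Qed.

Lemma reidx_tri_nat {A B D : S} {f : A ⟶ B} {g : B ⟶ D} {h : A ⟶ D}
    (e : g ∘ f = h) {M N : fib C D} (u : M ⟶ N) :
  reidx_tri e N ∘ fmap (f^*) (fmap (g^*) u) = fmap (h^*) u ∘ reidx_tri e M.
Proof.
  pose proof (mni_nat (reidx_comp C f g) u) as H. simpl in *.
  now rewrite <- comp_assoc, H, comp_assoc, reidx_eq_nat, comp_assoc.
Qed.

Lemma inv_nat {K : Category} {x x' y y' : K} (i : Iso x x') (j : Iso y y')
    (f : x ⟶ y) (f' : x' ⟶ y') : j ∘ f = f' ∘ i -> bwd j ∘ f' = f ∘ bwd i.
Proof.
  intros H.
  rewrite <- (comp_idr f'), <- (fwd_bwd i), (comp_assoc f'), <- H.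
  now rewrite !comp_assoc, bwd_fwd, comp_idl.
Qed.

Definition reidx_inverse {A B : S} {f : A ⟶ B} {g : B ⟶ A} (e : g ∘ f = idm A)
    (M : fib C A) : Iso (f^* (g^* M)) M :=
  reidx_tri e M ;; inv (reidx_id C A M).

Lemma reidx_inverse_nat {A B : S} {f : A ⟶ B} {g : B ⟶ A} (e : g ∘ f = idm A)
    {M N : fib C A} (u : M ⟶ N) :
  reidx_inverse e N ∘ fmap (f^*) (fmap (g^*) u) = u ∘ reidx_inverse e M.
Proof.
  unfold reidx_inverse. cbn [fwd iso_comp].
  rewrite <- comp_assoc, reidx_tri_nat, !comp_assoc. f_equal.
  apply (inv_nat (i := reidx_id C A M) (j := reidx_id C A N) (f := u)).
  exact (mni_nat (reidx_id C A) u).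
Qed.

(** ** Pushforward, Beck-Chevalley and projection morphisms *)

Context (push : forall (A B : S) (f : A ⟶ B), LeftAdjoint (f^*)).
Local Notation "Σ[ f ]" := (push f) (at level 0, format "Σ[ f ]").

Definition bc_map {A B D E : S} {f : A ⟶ B} {h : A ⟶ D} {g : B ⟶ E} {k : D ⟶ E}
    (e : g ∘ f = k ∘ h) (M : fib C D) : Σ[f] (h^* M) ⟶ g^* (Σ[k] M) :=
  adj_counit Σ[f] (g^* (Σ[k] M))
  ∘ fmap Σ[f] (inv (reidx_sq e (Σ[k] M)))
  ∘ fmap Σ[f] (fmap (h^*) (adj_unit Σ[k] M)).

Definition proj_map {A B : S} (f : A ⟶ B) (M : fib C B) (N : fib C A) :
  Σ[f] (f^* M ⊗ N) ⟶ M ⊗ Σ[f] N :=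
  adj_counit Σ[f] (M ⊗ Σ[f] N)
  ∘ fmap Σ[f] (smf_mu (f^*) M (Σ[f] N))
  ∘ fmap Σ[f] (idm (f^* M) ⊗₁ adj_unit Σ[f] N).

End Reindexing.

(** * Indexed homotopy coproducts preserved by the tensor product *)

Section BasicSquares.
Context {S : Category} (P : FiniteProducts S).
Local Notation "A × B" := (prod P A B).
Local Notation "⟨ f , g ⟩" := (pair P f g).

Definition prod_map {A A' B B' : S} (f : A ⟶ A') (g : B ⟶ B') : A × B ⟶ A' × B' :=
  ⟨f ∘ fst P A B, g ∘ snd P A B⟩.
Local Notation "f ×₁ g" := (prod_map f g) (at level 36, left associativity).

Definition diag (A : S) : A ⟶ A × A := ⟨idm A, idm A⟩.

Definition prod_assoc (A B D : S) : (A × B) × D ⟶ A × (B × D) :=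
  ⟨fst P A B ∘ fst P (A × B) D, ⟨snd P A B ∘ fst P (A × B) D, snd P (A × B) D⟩⟩.

(* [BasicSquare f h g k] : the square with top [f], left [h], right [g] and bottom
   [k] is one of the squares that are required to be homotopy pullback squares.
   Since products are only associative, unital and symmetric up to isomorphism, the
   family is taken up to isomorphism of squares ([sq_iso]); invertibility of the
   Beck-Chevalley morphism is invariant under such isomorphisms. *)
Inductive BasicSquare :
    forall A B D E : S, A ⟶ B -> A ⟶ D -> B ⟶ E -> D ⟶ E -> Prop :=
| sq_a : forall (A B D E : S) (f : A ⟶ B) (g : D ⟶ E),
    BasicSquare (f ×₁ idm D) (idm A ×₁ g) (idm B ×₁ g) (f ×₁ idm E)
| sq_b : forall A : S,
    BasicSquare (diag A) (diag A) (idm A ×₁ diag A)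
                (prod_assoc A A A ∘ (diag A ×₁ idm A))
| sq_c : forall (A B : S) (f : A ⟶ B),
    BasicSquare ⟨idm A, f⟩ f (f ×₁ idm B) (diag B)
| sq_transpose : forall (A B D E : S)
    (f : A ⟶ B) (h : A ⟶ D) (g : B ⟶ E) (k : D ⟶ E),
    BasicSquare f h g k -> BasicSquare h f k g
| sq_prod : forall (X A B D E : S)
    (f : A ⟶ B) (h : A ⟶ D) (g : B ⟶ E) (k : D ⟶ E),
    BasicSquare f h g k ->
    BasicSquare (idm X ×₁ f) (idm X ×₁ h) (idm X ×₁ g) (idm X ×₁ k)
| sq_iso : forall (A B D E A' B' D' E' : S)
    (f : A ⟶ B) (h : A ⟶ D) (g : B ⟶ E) (k : D ⟶ E)
    (f' : A' ⟶ B') (h' : A' ⟶ D') (g' : B' ⟶ E') (k' : D' ⟶ E')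
    (a : Iso A A') (b : Iso B B') (d : Iso D D') (e : Iso E E'),
    b ∘ f = f' ∘ a -> d ∘ h = h' ∘ a -> e ∘ g = g' ∘ b -> e ∘ k = k' ∘ d ->
    BasicSquare f h g k -> BasicSquare f' h' g' k'.

End BasicSquares.

Record HoCoproducts (S : Category) (P : FiniteProducts S) (C : IndexedSMC S) := {
  push : forall (A B : S) (f : A ⟶ B), LeftAdjoint (reidx C f);
  hpb : forall A B D E : S, A ⟶ B -> A ⟶ D -> B ⟶ E -> D ⟶ E -> Prop;
  hpb_basic : forall (A B D E : S) (f : A ⟶ B) (h : A ⟶ D) (g : B ⟶ E) (k : D ⟶ E),
    BasicSquare P f h g k -> hpb f h g k;
  bc_isiso : forall (A B D E : S) (f : A ⟶ B) (h : A ⟶ D) (g : B ⟶ E) (k : D ⟶ E)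
      (e : g ∘ f = k ∘ h),
    hpb f h g k -> forall M : fib C D, IsIso (bc_map push e M);
  proj_isiso : forall (A B : S) (f : A ⟶ B) (M : fib C B) (N : fib C A),
    IsIso (proj_map push f M N)
}.

Section ProductLemmas.
Context {S : Category} {P : FiniteProducts S}.

Lemma pair_comp (X Y A B : S) (f : X ⟶ A) (g : X ⟶ B) (h : Y ⟶ X) :
  pair P f g ∘ h = pair P (f ∘ h) (g ∘ h).
Proof.
  apply pair_ext; now rewrite comp_assoc, ?fst_pair, ?snd_pair.
Qed.

Lemma fst_pair_comp (X Y A B : S) (f : X ⟶ A) (g : X ⟶ B) (h : Y ⟶ X) :
  fst P A B ∘ (pair P f g ∘ h) = f ∘ h.
Proof. now rewrite comp_assoc, fst_pair. Qed.

Lemma snd_pair_comp (X Y A B : S) (f : X ⟶ A) (g : X ⟶ B) (h : Y ⟶ X) :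
  snd P A B ∘ (pair P f g ∘ h) = g ∘ h.
Proof. now rewrite comp_assoc, snd_pair. Qed.

End ProductLemmas.

Ltac prod_simpl :=
  cbn; unfold prod_map, diag, prod_assoc;
  repeat progress rewrite ?comp_idl, ?comp_idr, <- ?comp_assoc, ?pair_comp,
    ?fst_pair, ?snd_pair, ?fst_pair_comp, ?snd_pair_comp.

Ltac prod_eq :=
  prod_simpl; try reflexivity;
  solve [apply bang_unique | apply pair_ext; prod_eq].

(** * The bicategory of an indexed symmetric monoidal category *)

Section Bicategory.
Context {S : Category} {P : FiniteProducts S} {C : IndexedSMC S}.
Context (H : HoCoproducts P C).

Local Notation "A × B" := (prod P A B).
Local Notation "⟨ f , g ⟩" := (pair P f g).
Local Notation "f ×₁ g" := (prod_map P f g) (at level 36, left associativity).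
Local Notation "⋆" := (star P).
Local Notation π := (bang P).
Local Notation Δ := (diag P).
Local Notation π₁ := (fst P _ _).
Local Notation π₂ := (snd P _ _).
Local Notation "f ^*" := (reidx C f) (at level 2, left associativity, format "f ^*").
Local Notation "Σ[ f ]" := (push H f) (at level 0, format "Σ[ f ]").

(** ** Canonical isomorphisms *)

Definition push_id (A : S) (M : fib C A) : Iso (Σ[idm A] M) M :=
  inv (adj_unique adj_id Σ[idm A] (mni_nat (reidx_id C A)) M).

Definition push_comp {A B D : S} (f : A ⟶ B) (g : B ⟶ D) (M : fib C A) :
  Iso (Σ[g] (Σ[f] M)) (Σ[g ∘ f] M) :=
  adj_unique (adj_comp Σ[f] Σ[g]) Σ[g ∘ f] (mni_nat (reidx_comp C f g)) M.

Definition push_eq {A B : S} {f g : A ⟶ B} (e : f = g) (M : fib C A) :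
  Iso (Σ[f] M) (Σ[g] M) :=
  eq_iso (f_equal (fun h => Σ[h] M) e).

Definition push_tri {A B D : S} {f : A ⟶ B} {g : B ⟶ D} {h : A ⟶ D}
    (e : g ∘ f = h) (M : fib C A) : Iso (Σ[g] (Σ[f] M)) (Σ[h] M) :=
  push_comp f g M ;; push_eq e M.

Definition beck_chevalley {A B D E : S} {f : A ⟶ B} {h : A ⟶ D} {g : B ⟶ E} {k : D ⟶ E}
    (e : g ∘ f = k ∘ h) (b : BasicSquare P f h g k) (M : fib C D) :
  Iso (Σ[f] (h^* M)) (g^* (Σ[k] M)) :=
  iso_of (bc_isiso e (hpb_basic H b) M).

Definition projection {A B : S} (f : A ⟶ B) (M : fib C B) (N : fib C A) :
  Iso (Σ[f] (f^* M ⊗ N)) (M ⊗ Σ[f] N) :=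
  iso_of (proj_isiso H f M N).

(** ** The external product *)

Definition box {A B : S} (M : fib C A) (N : fib C B) : fib C (A × B) :=
  (fst P A B)^* M ⊗ (snd P A B)^* N.
Local Notation "M ⊠ N" := (box M N) (at level 37, right associativity).

Definition box_map {A B : S} {M M' : fib C A} {N N' : fib C B}
    (u : M ⟶ M') (v : N ⟶ N') : M ⊠ N ⟶ M' ⊠ N' :=
  fmap ((fst P A B)^*) u ⊗₁ fmap ((snd P A B)^*) v.

Definition box_iso {A B : S} {M M' : fib C A} {N N' : fib C B}
    (u : Iso M M') (v : Iso N N') : Iso (M ⊠ N) (M' ⊠ N') :=
  tens_iso (fmap_iso ((fst P A B)^*) u) (fmap_iso ((snd P A B)^*) v).

Definition pair_box {X A B : S} (f : X ⟶ A) (g : X ⟶ B) (M : fib C A) (N : fib C B) :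
  Iso (⟨f, g⟩^* (M ⊠ N)) (f^* M ⊗ g^* N) :=
  inv (smf_mu (⟨f, g⟩^*) _ _)
  ;; tens_iso (reidx_tri (fst_pair P f g) M) (reidx_tri (snd_pair P f g) N).

Definition box_reidx {A A' B B' : S} (f : A ⟶ A') (g : B ⟶ B')
    (M : fib C A') (N : fib C B') :
  Iso (f^* M ⊠ g^* N) ((f ×₁ g)^* (M ⊠ N)) :=
  tens_iso (reidx_comp C π₁ f M) (reidx_comp C π₂ g N)
  ;; inv (pair_box (f ∘ π₁) (g ∘ π₂) M N).

Definition box_reidx_l {A A' B : S} (f : A ⟶ A') (M : fib C A') (N : fib C B) :
  Iso (f^* M ⊠ N) ((f ×₁ idm B)^* (M ⊠ N)) :=
  box_iso (iso_id _) (reidx_id C B N) ;; box_reidx f (idm B) M N.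

Definition box_reidx_r {A B B' : S} (g : B ⟶ B') (M : fib C A) (N : fib C B') :
  Iso (M ⊠ g^* N) ((idm A ×₁ g)^* (M ⊠ N)) :=
  box_iso (reidx_id C A M) (iso_id _) ;; box_reidx (idm A) g M N.

(* [fst^* (M ⊠ N) ⊗ snd^* L ≅ (a^* M ⊗ b^* N) ⊗ d^* L ≅ a^* M ⊗ (b^* N ⊗ d^* L)],
   where [a], [b], [d] are the three projections of [(A × B) × D]. *)
Definition box_assoc {A B D : S} (M : fib C A) (N : fib C B) (L : fib C D) :
  Iso ((M ⊠ N) ⊠ L) ((prod_assoc P A B D)^* (M ⊠ (N ⊠ L))) :=
  tens_iso
    (inv (smf_mu ((fst P (A × B) D)^*) _ _)
     ;; tens_iso (reidx_comp C π₁ π₁ M) (reidx_comp C π₁ π₂ N))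
    (iso_id _)
  ;; assoc _ _ _
  ;; tens_iso (iso_id _) (inv (pair_box (π₂ ∘ π₁) π₂ N L))
  ;; inv (pair_box (π₁ ∘ π₁) ⟨π₂ ∘ π₁, π₂⟩ M (N ⊠ L)).

Definition swap (A B : S) : A × B ⟶ B × A := ⟨snd P A B, fst P A B⟩.

Definition box_swap {A B : S} (M : fib C A) (N : fib C B) :
  Iso (M ⊠ N) ((swap A B)^* (N ⊠ M)) :=
  braid_iso _ _ ;; inv (pair_box (snd P A B) (fst P A B) N M).

Definition box_unit_r {A : S} (M : fib C A) :
  Iso (M ⊠ (munit : fib C ⋆)) ((fst P A ⋆)^* M) :=
  tens_iso (iso_id _) (inv (smf_eps ((snd P A ⋆)^*))) ;; runit _.

Definition box_unit_l {A : S} (M : fib C A) :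
  Iso ((munit : fib C ⋆) ⊠ M) ((snd P ⋆ A)^* M) :=
  tens_iso (inv (smf_eps ((fst P ⋆ A)^*))) (iso_id _) ;; lunit _.

Lemma box_push_l_eq {A B : S} (f : A ⟶ B) (X : S) :
  fst P B X ∘ (f ×₁ idm X) = f ∘ fst P A X.
Proof. prod_eq. Qed.

Definition prod_star_r (A : S) : Iso (A × ⋆) A.
Proof.
  refine {| fwd := fst P A ⋆; bwd := ⟨idm A, π A⟩ |}; prod_eq.
Defined.

Definition prod_star_l (A : S) : Iso (⋆ × A) A.
Proof.
  refine {| fwd := snd P ⋆ A; bwd := ⟨π A, idm A⟩ |}; prod_eq.
Defined.

Lemma box_push_l_basic {A B : S} (f : A ⟶ B) (X : S) :
  BasicSquare P (f ×₁ idm X) (fst P A X) (fst P B X) f.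
Proof.
  refine (sq_iso (a := iso_id _) (b := iso_id _) (d := prod_star_r A)
            (e := prod_star_r B) _ _ _ _ (sq_a P f (π X))); prod_eq.
Qed.

Lemma box_push_r_basic {A B : S} (f : A ⟶ B) (X : S) :
  BasicSquare P (idm X ×₁ f) (snd P X A) (snd P X B) f.
Proof.
  refine (sq_iso (a := iso_id _) (b := iso_id _) (d := prod_star_l A)
            (e := prod_star_l B) _ _ _ _ (sq_transpose (sq_a P (π X) f))); prod_eq.
Qed.

Lemma box_push_r_eq {A B : S} (f : A ⟶ B) (X : S) :
  snd P X B ∘ (idm X ×₁ f) = f ∘ snd P X A.
Proof. prod_eq. Qed.

Lemma prod_map_id_snd {A B : S} (f : A ⟶ B) (X : S) :
  snd P B X ∘ (f ×₁ idm X) = snd P A X.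
Proof. prod_eq. Qed.

Lemma prod_map_id_fst {A B : S} (f : A ⟶ B) (X : S) :
  fst P X B ∘ (idm X ×₁ f) = fst P X A.
Proof. prod_eq. Qed.

(* Compatibility of [⊠] with pushforward, in each variable. *)
Definition box_push_l {A B X : S} (f : A ⟶ B) (M : fib C A) (N : fib C X) :
  Iso (Σ[f] M ⊠ N) (Σ[f ×₁ idm X] (M ⊠ N)) :=
  tens_iso (inv (beck_chevalley (box_push_l_eq f X) (box_push_l_basic f X) M)) (iso_id _)
  ;; braid_iso _ _
  ;; inv (projection (f ×₁ idm X) (π₂^* N) (π₁^* M))
  ;; fmap_iso Σ[f ×₁ idm X]
       (braid_iso _ _ ;; tens_iso (iso_id _) (reidx_tri (prod_map_id_snd f X) N)).

Definition box_push_r {A B X : S} (f : A ⟶ B) (N : fib C X) (M : fib C A) :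
  Iso (N ⊠ Σ[f] M) (Σ[idm X ×₁ f] (N ⊠ M)) :=
  tens_iso (iso_id _) (inv (beck_chevalley (box_push_r_eq f X) (box_push_r_basic f X) M))
  ;; inv (projection (idm X ×₁ f) (π₁^* N) (π₂^* M))
  ;; fmap_iso Σ[idm X ×₁ f] (tens_iso (reidx_tri (prod_map_id_fst f X) N) (iso_id _)).

(** ** Composition and units *)

(* [dup] is id × Δ × id and [mid] is id × π × id. *)
Definition dup (A B D : S) : (A × B) × D ⟶ (A × B) × (B × D) :=
  ⟨π₁, ⟨π₂ ∘ π₁, π₂⟩⟩.

Definition mid (A B D : S) : (A × B) × D ⟶ A × D := ⟨π₁ ∘ π₁, π₂⟩.

Definition hcomp {A B D : S} (M : fib C (A × B)) (N : fib C (B × D)) : fib C (A × D) :=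
  Σ[mid A B D] ((dup A B D)^* (M ⊠ N)).
Local Notation "M ⊙ N" := (hcomp M N) (at level 39, right associativity).

Definition hcomp_map {A B D : S} {M M' : fib C (A × B)} {N N' : fib C (B × D)}
    (u : M ⟶ M') (v : N ⟶ N') : M ⊙ N ⟶ M' ⊙ N' :=
  fmap Σ[mid A B D] (fmap ((dup A B D)^*) (box_map u v)).
Local Notation "u ⊙₁ v" := (hcomp_map u v) (at level 39, right associativity).

Definition hunit (A : S) : fib C (A × A) := Σ[Δ A] ((π A)^* munit).

(** ** Homotopy pullback squares used below *)

Definition prod_assoc_iso (X Y Z : S) : Iso ((X × Y) × Z) (X × (Y × Z)).
Proof.
  refine {| fwd := prod_assoc P X Y Z; bwd := ⟨⟨π₁, π₁ ∘ π₂⟩, π₂ ∘ π₂⟩ |}; prod_eq.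
Defined.

Definition swap_iso (X Y : S) : Iso (X × Y) (Y × X).
Proof.
  refine {| fwd := swap X Y; bwd := swap Y X |}; unfold swap; prod_eq.
Defined.

Lemma assoc_l_eq (A B D E : S) :
  dup A D E ∘ (mid A B D ×₁ idm E) = (mid A B D ×₁ idm (D × E)) ∘ dup (A × B) D E.
Proof. unfold dup, mid. prod_eq. Qed.

Lemma assoc_l_basic (A B D E : S) :
  BasicSquare P (mid A B D ×₁ idm E) (dup (A × B) D E)
    (dup A D E) (mid A B D ×₁ idm (D × E)).
Proof.
  refine (sq_iso (a := inv (prod_assoc_iso (A × B) D E))
            (b := inv (prod_assoc_iso A D E))
            (d := inv (prod_assoc_iso (A × B) D (D × E)))
            (e := inv (prod_assoc_iso A D (D × E))) _ _ _ _
            (sq_a P (fst P A B) ⟨fst P D E, idm (D × E)⟩)); unfold dup, mid; prod_eq.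
Qed.

(* ((a, b), d), e) ↦ ((a, b), ((b, d), e)) *)
Definition dup_shift (A B D E : S) : ((A × B) × D) × E ⟶ (A × B) × ((B × D) × E) :=
  ⟨π₁ ∘ π₁, ⟨⟨π₂ ∘ (π₁ ∘ π₁), π₂ ∘ π₁⟩, π₂⟩⟩.

Lemma assoc_r_eq (A B D E : S) :
  dup A B E ∘ mid (A × B) D E = (idm (A × B) ×₁ mid B D E) ∘ dup_shift A B D E.
Proof. unfold dup, mid, dup_shift. prod_eq. Qed.

Lemma assoc_r_basic (A B D E : S) :
  BasicSquare P (mid (A × B) D E) (dup_shift A B D E)
    (dup A B E) (idm (A × B) ×₁ mid B D E).
Proof.
  assert (d : { d : Iso (((A × B) × B) × (D × E)) ((A × B) × ((B × D) × E)) |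
              fwd d = ⟨π₁ ∘ π₁, ⟨⟨π₂ ∘ π₁, π₁ ∘ π₂⟩, π₂ ∘ π₂⟩⟩ }).
  { unshelve eexists {| fwd := ⟨π₁ ∘ π₁, ⟨⟨π₂ ∘ π₁, π₁ ∘ π₂⟩, π₂ ∘ π₂⟩⟩;
                bwd := ⟨⟨π₁, π₁ ∘ (π₁ ∘ π₂)⟩, ⟨π₂ ∘ (π₁ ∘ π₂), π₂ ∘ π₂⟩⟩ |};
    prod_eq. }
  destruct d as [d Hd].
  refine (sq_iso (a := inv (prod_assoc_iso (A × B) D E)) (b := iso_id _)
            (d := d) (e := prod_assoc_iso (A × B) B E) _ _ _ _
            (sq_transpose (sq_a P ⟨idm (A × B), snd P A B⟩ (snd P D E))));
  rewrite ?Hd; unfold dup, mid, dup_shift; prod_eq.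
Qed.

(* (a, b) ↦ ((a, b), b) and (a, b) ↦ (a, (a, b)) *)
Definition dup_r (A B : S) : A × B ⟶ (A × B) × B := ⟨idm (A × B), π₂⟩.
Definition dup_l (A B : S) : A × B ⟶ A × (A × B) := ⟨π₁, idm (A × B)⟩.

Lemma unit_r_eq (A B : S) :
  dup A B B ∘ dup_r A B = (idm (A × B) ×₁ Δ B) ∘ dup_r A B.
Proof. unfold dup, dup_r. prod_eq. Qed.

Lemma unit_r_basic (A B : S) :
  BasicSquare P (dup_r A B) (dup_r A B) (dup A B B) (idm (A × B) ×₁ Δ B).
Proof.
  refine (sq_iso (a := iso_id _) (b := inv (prod_assoc_iso A B B))
            (d := inv (prod_assoc_iso A B B))
            (e := inv (prod_assoc_iso A B (B × B))) _ _ _ _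
            (sq_prod A (sq_transpose (sq_b P B)))); unfold dup, dup_r; prod_eq.
Qed.

Lemma unit_l_eq (A B : S) :
  dup A A B ∘ (Δ A ×₁ idm B) = (Δ A ×₁ idm (A × B)) ∘ dup_l A B.
Proof. unfold dup, dup_l. prod_eq. Qed.

Lemma unit_l_basic (A B : S) :
  BasicSquare P (Δ A ×₁ idm B) (dup_l A B) (dup A A B) (Δ A ×₁ idm (A × B)).
Proof.
  assert (d : { d : Iso (B × (A × A)) (A × (A × B)) |
              fwd d = ⟨π₁ ∘ π₂, ⟨π₂ ∘ π₂, π₁⟩⟩ }).
  { unshelve eexists {| fwd := ⟨π₁ ∘ π₂, ⟨π₂ ∘ π₂, π₁⟩⟩;
                bwd := ⟨π₂ ∘ π₂, ⟨π₁, π₁ ∘ π₂⟩⟩ |}; prod_eq. }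
  assert (e : { e : Iso (B × (A × (A × A))) ((A × A) × (A × B)) |
              fwd e = ⟨⟨π₁ ∘ π₂, π₁ ∘ (π₂ ∘ π₂)⟩, ⟨π₂ ∘ (π₂ ∘ π₂), π₁⟩⟩ }).
  { unshelve eexists
      {| fwd := ⟨⟨π₁ ∘ π₂, π₁ ∘ (π₂ ∘ π₂)⟩, ⟨π₂ ∘ (π₂ ∘ π₂), π₁⟩⟩;
         bwd := ⟨π₂ ∘ π₂, ⟨π₁ ∘ π₁, ⟨π₂ ∘ π₁, π₁ ∘ π₂⟩⟩⟩ |}; prod_eq. }
  destruct d as [d Hd]; destruct e as [e He].
  refine (sq_iso (a := swap_iso B A) (b := swap_iso B (A × A)) (d := d) (e := e)
            _ _ _ _ (sq_prod B (sq_b P A)));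
  rewrite ?Hd, ?He; unfold dup, dup_l; cbn; unfold swap; prod_eq.
Qed.

Lemma shadow_l_eq (A B : S) :
  Δ A ∘ fst P A B = mid A B A ∘ ⟨idm (A × B), fst P A B⟩.
Proof. unfold mid. prod_eq. Qed.

Lemma shadow_l_basic (A B : S) :
  BasicSquare P (fst P A B) ⟨idm (A × B), fst P A B⟩ (Δ A) (mid A B A).
Proof.
  assert (d : { d : Iso (B × (A × A)) ((A × B) × A) |
              fwd d = ⟨⟨π₁ ∘ π₂, π₁⟩, π₂ ∘ π₂⟩ }).
  { unshelve eexists {| fwd := ⟨⟨π₁ ∘ π₂, π₁⟩, π₂ ∘ π₂⟩;
                bwd := ⟨π₂ ∘ π₁, ⟨π₁ ∘ π₁, π₂⟩⟩ |}; prod_eq. }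
  destruct d as [d Hd].
  refine (sq_iso (a := swap_iso B A) (b := prod_star_l A) (d := d)
            (e := prod_star_l (A × A)) _ _ _ _ (sq_a P (π B) (Δ A)));
  rewrite ?Hd; unfold mid; cbn; unfold swap; prod_eq.
Qed.

Lemma shadow_r_eq (A B : S) :
  Δ B ∘ snd P A B = mid B A B ∘ ⟨swap A B, snd P A B⟩.
Proof. unfold mid, swap. prod_eq. Qed.

Lemma shadow_r_basic (A B : S) :
  BasicSquare P (snd P A B) ⟨swap A B, snd P A B⟩ (Δ B) (mid B A B).
Proof.
  refine (sq_iso (a := swap_iso B A) (b := iso_id _) (d := iso_id _) (e := iso_id _)
            _ _ _ _ (shadow_l_basic B A));
  cbn; unfold mid, swap; prod_eq.
Qed.

(** ** Associator *)

Definition mid3 (A B D E : S) : ((A × B) × D) × E ⟶ A × E := ⟨π₁ ∘ (π₁ ∘ π₁), π₂⟩.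

Definition dup3 (A B D E : S) :
    ((A × B) × D) × E ⟶ ((A × B) × (B × D)) × (D × E) :=
  ⟨dup A B D ∘ π₁, ⟨π₂ ∘ π₁, π₂⟩⟩.

Definition hcomp3 {A B D E : S}
    (M : fib C (A × B)) (N : fib C (B × D)) (L : fib C (D × E)) : fib C (A × E) :=
  Σ[mid3 A B D E] ((dup3 A B D E)^* ((M ⊠ N) ⊠ L)).


Lemma assoc_mid_l (A B D E : S) :
  mid A D E ∘ (mid A B D ×₁ idm E) = mid3 A B D E.
Proof. unfold mid, mid3. prod_eq. Qed.

Lemma assoc_mid_r (A B D E : S) :
  mid A B E ∘ mid (A × B) D E = mid3 A B D E.
Proof. unfold mid, mid3. prod_eq. Qed.

Lemma assoc_dup_l (A B D E : S) :
  (dup A B D ×₁ idm (D × E)) ∘ dup (A × B) D E = dup3 A B D E.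
Proof. unfold dup3, dup. prod_eq. Qed.

Lemma assoc_dup_r (A B D E : S) :
  (idm (A × B) ×₁ dup B D E) ∘ dup_shift A B D E
  = prod_assoc P (A × B) (B × D) (D × E) ∘ dup3 A B D E.
Proof. unfold dup_shift, dup3, dup. prod_eq. Qed.

Section Associator.
Context {A B D E : S}.
Context (M : fib C (A × B)) (N : fib C (B × D)) (L : fib C (D × E)).

Definition hcomp3_l : Iso ((M ⊙ N) ⊙ L) (hcomp3 M N L) :=
  fmap_iso Σ[mid A D E]
    (fmap_iso ((dup A D E)^*) (box_push_l (mid A B D) ((dup A B D)^* (M ⊠ N)) L)
     ;; inv (beck_chevalley (assoc_l_eq A B D E) (assoc_l_basic A B D E) _))
  ;; push_tri (assoc_mid_l A B D E) _
  ;; fmap_iso Σ[mid3 A B D E]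
       (fmap_iso ((dup (A × B) D E)^*) (box_reidx_l (dup A B D) (M ⊠ N) L)
        ;; reidx_tri (assoc_dup_l A B D E) _).

Definition hcomp3_r : Iso (M ⊙ (N ⊙ L)) (hcomp3 M N L) :=
  fmap_iso Σ[mid A B E]
    (fmap_iso ((dup A B E)^*) (box_push_r (mid B D E) M ((dup B D E)^* (N ⊠ L)))
     ;; inv (beck_chevalley (assoc_r_eq A B D E) (assoc_r_basic A B D E) _))
  ;; push_tri (assoc_mid_r A B D E) _
  ;; fmap_iso Σ[mid3 A B D E]
       (fmap_iso ((dup_shift A B D E)^*) (box_reidx_r (dup B D E) M (N ⊠ L))
        ;; reidx_sq (assoc_dup_r A B D E) _
        ;; fmap_iso ((dup3 A B D E)^*) (inv (box_assoc M N L))).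

Definition hassoc : Iso ((M ⊙ N) ⊙ L) (M ⊙ (N ⊙ L)) := hcomp3_l ;; inv hcomp3_r.

End Associator.

(** ** Unitors *)

Lemma unit_r_mid (A B : S) : mid A B B ∘ dup_r A B = idm (A × B).
Proof. unfold mid, dup_r. prod_eq. Qed.

Lemma unit_l_mid (A B : S) : mid A A B ∘ (Δ A ×₁ idm B) = idm (A × B).
Proof. unfold mid. prod_eq. Qed.

Lemma unit_r_dup (A B : S) :
  fst P (A × B) ⋆ ∘ ((idm (A × B) ×₁ π B) ∘ dup_r A B) = idm (A × B).
Proof. unfold dup_r. prod_eq. Qed.

Lemma unit_l_dup (A B : S) :
  snd P ⋆ (A × B) ∘ ((π A ×₁ idm (A × B)) ∘ dup_l A B) = idm (A × B).
Proof. unfold dup_l. prod_eq. Qed.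

Section Unitors.
Context {A B : S} (M : fib C (A × B)).

Definition hrunit : Iso (M ⊙ hunit B) M :=
  fmap_iso Σ[mid A B B]
    (fmap_iso ((dup A B B)^*) (box_push_r (Δ B) M ((π B)^* munit))
     ;; inv (beck_chevalley (unit_r_eq A B) (unit_r_basic A B) _))
  ;; push_tri (unit_r_mid A B) _
  ;; push_id _
  ;; fmap_iso ((dup_r A B)^*)
       (box_reidx_r (π B) M munit
        ;; fmap_iso ((idm (A × B) ×₁ π B)^*) (box_unit_r M))
  ;; reidx_comp C (dup_r A B) (idm (A × B) ×₁ π B) _
  ;; reidx_tri (unit_r_dup A B) M
  ;; inv (reidx_id C (A × B) M).

Definition hlunit : Iso (hunit A ⊙ M) M :=
  fmap_iso Σ[mid A A B]
    (fmap_iso ((dup A A B)^*) (box_push_l (Δ A) ((π A)^* munit) M)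
     ;; inv (beck_chevalley (unit_l_eq A B) (unit_l_basic A B) _))
  ;; push_tri (unit_l_mid A B) _
  ;; push_id _
  ;; fmap_iso ((dup_l A B)^*)
       (box_reidx_l (π A) munit M
        ;; fmap_iso ((π A ×₁ idm (A × B))^*) (box_unit_l M))
  ;; reidx_comp C (dup_l A B) (π A ×₁ idm (A × B)) _
  ;; reidx_tri (unit_l_dup A B) M
  ;; inv (reidx_id C (A × B) M).

End Unitors.

(** ** Shadow *)

Definition shadow {A : S} (M : fib C (A × A)) : fib C ⋆ := Σ[π A] ((Δ A)^* M).

Definition shadow_map {A : S} {M N : fib C (A × A)} (u : M ⟶ N) : shadow M ⟶ shadow N :=
  fmap Σ[π A] (fmap ((Δ A)^*) u).

(* (a, b) ↦ ((a, b), (b, a)) and (a, b) ↦ ((b, a), (a, b)) *)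
Definition cyc (A B : S) : A × B ⟶ (A × B) × (B × A) := ⟨idm (A × B), swap A B⟩.
Definition cyc' (A B : S) : A × B ⟶ (B × A) × (A × B) := ⟨swap A B, idm (A × B)⟩.

Lemma cyc_l (A B : S) : dup A B A ∘ ⟨idm (A × B), fst P A B⟩ = cyc A B.
Proof. unfold dup, cyc, swap. prod_eq. Qed.

Lemma cyc_r (A B : S) : dup B A B ∘ ⟨swap A B, snd P A B⟩ = cyc' A B.
Proof. unfold dup, cyc', swap. prod_eq. Qed.

Lemma cyc_swap (A B : S) : swap (A × B) (B × A) ∘ cyc A B = cyc' A B.
Proof. unfold cyc, cyc', swap. prod_eq. Qed.

Section Theta.
Context {A B : S} (M : fib C (A × B)) (N : fib C (B × A)).

Definition shadow_l : Iso (shadow (M ⊙ N)) (Σ[π (A × B)] ((cyc A B)^* (M ⊠ N))) :=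
  fmap_iso Σ[π A] (inv (beck_chevalley (shadow_l_eq A B) (shadow_l_basic A B) _))
  ;; push_tri (@bang_unique S P (A × B) (π A ∘ fst P A B) (π (A × B))) _
  ;; fmap_iso Σ[π (A × B)] (reidx_tri (cyc_l A B) (M ⊠ N)).

Definition shadow_r : Iso (shadow (N ⊙ M)) (Σ[π (A × B)] ((cyc' A B)^* (N ⊠ M))) :=
  fmap_iso Σ[π B] (inv (beck_chevalley (shadow_r_eq A B) (shadow_r_basic A B) _))
  ;; push_tri (@bang_unique S P (A × B) (π B ∘ snd P A B) (π (A × B))) _
  ;; fmap_iso Σ[π (A × B)] (reidx_tri (cyc_r A B) (N ⊠ M)).

Definition theta : Iso (shadow (M ⊙ N)) (shadow (N ⊙ M)) :=
  shadow_l
  ;; fmap_iso Σ[π (A × B)]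
       (fmap_iso ((cyc A B)^*) (box_swap M N) ;; reidx_tri (cyc_swap A B) (N ⊠ M))
  ;; inv shadow_r.

End Theta.

(* On endo-1-cells of the terminal object the shadow is the identity, under the
   equivalence of [fib C (⋆ × ⋆)] with [fib C ⋆] given by reindexing along [Δ ⋆]. *)
Definition shadow_star (M : fib C (⋆ × ⋆)) : Iso (shadow M) ((Δ ⋆)^* M) :=
  push_eq (@bang_unique S P ⋆ (π ⋆) (idm ⋆)) _ ;; push_id _.

Lemma diag_star_l : fst P ⋆ ⋆ ∘ Δ ⋆ = idm ⋆.
Proof. prod_eq. Qed.

Lemma diag_star_r : Δ ⋆ ∘ fst P ⋆ ⋆ = idm (⋆ × ⋆).
Proof. prod_eq. Qed.

Definition hunit_star : Iso ((Δ ⋆)^* (hunit ⋆)) (munit : fib C ⋆) :=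
  inv (iso_of (adj_unit_isiso Σ[Δ ⋆] (K := (fst P ⋆ ⋆)^*)
                 (fun y y' f => reidx_inverse_nat diag_star_r f)
                 (fun x x' f => reidx_inverse_nat diag_star_l f)
                 ((π ⋆)^* munit)))
  ;; inv (smf_eps ((π ⋆)^*)).

Definition shadow_hunit_star : Iso (shadow (hunit ⋆)) (munit : fib C ⋆) :=
  shadow_star (hunit ⋆) ;; hunit_star.

(** ** Duality and trace *)

Record RightDual {A B : S} (M : fib C (A × B)) := {
  rdual : fib C (B × A);
  rcoev : hunit A ⟶ M ⊙ rdual;
  rev : rdual ⊙ M ⟶ hunit B;
  rdual_triangle_l :
    hrunit M ∘ (idm M ⊙₁ rev) ∘ hassoc M rdual M ∘ (rcoev ⊙₁ idm M) ∘ inv (hlunit M)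
    = idm M;
  rdual_triangle_r :
    hlunit rdual ∘ (rev ⊙₁ idm rdual) ∘ inv (hassoc rdual M rdual)
      ∘ (idm rdual ⊙₁ rcoev) ∘ inv (hrunit rdual)
    = idm rdual
}.

Definition bicat_trace {A B : S} {M : fib C (A × B)} (D : RightDual M)
    {Q : fib C (A × A)} {L : fib C (B × B)} (f : Q ⊙ M ⟶ M ⊙ L) : shadow Q ⟶ shadow L :=
  shadow_map (hlunit L)
  ∘ shadow_map (rev D ⊙₁ idm L)
  ∘ shadow_map (inv (hassoc (rdual D) M L))
  ∘ theta (M ⊙ L) (rdual D)
  ∘ shadow_map (f ⊙₁ idm (rdual D))
  ∘ shadow_map (inv (hassoc Q M (rdual D)))
  ∘ shadow_map (idm Q ⊙₁ rcoev D)
  ∘ shadow_map (inv (hrunit Q)).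

Definition bicat_endo_trace {A B : S} {M : fib C (A × B)} (D : RightDual M) (f : M ⟶ M) :
  shadow (hunit A) ⟶ shadow (hunit B) :=
  bicat_trace D (inv (hrunit M) ∘ f ∘ hlunit M).

(** ** Fiberwise objects as 1-cells *)

Definition hat {A : S} (M : fib C A) : fib C (A × ⋆) := (fst P A ⋆)^* M.

Definition hat_map {A : S} {M N : fib C A} (f : M ⟶ N) : hat M ⟶ hat N :=
  fmap ((fst P A ⋆)^*) f.

(* The trace of [hat_map f], with its target [shadow (hunit ⋆)] identified with the
   unit object of [fib C ⋆]. *)
Definition hat_trace {A : S} {M : fib C A} (D : RightDual (hat M)) (f : M ⟶ M) :
  shadow (hunit A) ⟶ (munit : fib C ⋆) :=
  shadow_hunit_star ∘ bicat_endo_trace D (hat_map f).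

(* [I_A ⟶ π^* π_! Δ^* Δ_! I_A ≅ π^* π_! Δ^* Δ_! π^* I_⋆] *)
Definition unit_to_shadow (A : S) : (munit : fib C A) ⟶ (π A)^* (shadow (hunit A)) :=
  fmap ((π A)^*) (fmap Σ[π A] (fmap ((Δ A)^*) (fmap Σ[Δ A] (smf_eps ((π A)^*)))))
  ∘ adj_unit Σ[π A] ((Δ A)^* (Σ[Δ A] munit))
  ∘ adj_unit Σ[Δ A] (munit : fib C A).

End Bicategory.

(* Main.v *)
From Stdlib Require Import ssreflect ssrfun ProofIrrelevance.
Require Import Defs.

(** The two traces are computed by the same string diagram once the 2-cells of the
    bicategory are tested on elements.

    A 1-cell [M : A → B] is a family of objects [M(a, b)].  For maps [a : T → A] and
    [b : T → B] of the base, a morphism [p : X ⟶ ⟨a, b⟩^* M] is treated as an element of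
    [M(a, b)] with parameters in [X], an object over [T].  There are four ways of making
    such elements: elements [p] of [M(a, b)] and [q] of [N(b, d)] have a product
    [hcomp_elt p q] of parameter [X ⊗ Y] in [(M ⊙ N)(a, d)]; every [a] has a unit element
    [hunit_elt a] in [U(a, a)]; an element of [M(a, a)] has a class [shadow_elt p] in the
    shadow of [M]; and 2-cells act on elements.  On these, all structure isomorphisms of
    the bicategory become those of the symmetric monoidal category over [T]:
    the associator sends [(p q) r] to [p (q r)] up to [assoc] ([hcomp_elt_assoc]), the
    unitors send [p 1] and [1 p] to [p] up to [runit] and [lunit] ([hcomp_elt_runit],
    [hcomp_elt_lunit]), and [theta] sends the class of [p q] to the class of [q p] up to
    [braid] ([shadow_elt_theta]).  These four formulas hold because each isomorphism in the
    definitions is characterised by its composites with cartesian morphisms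
    [f^* M → M] and with opcartesian morphisms [M → Σ[f] M].

    Now take [T = A].  Coevaluations [munit ⟶ M ⊗ N] in the fibre correspond to
    2-cells from [hunit A] to the composite of [hat M] with [N], the latter regarded as a
    1-cell [⋆ → A], because a map out of [hunit A = Σ[Δ] _] is given by its
    value on the unit element and because products over the terminal object [⋆] are
    invertible; evaluations correspond in the same way.  The element calculus
    carries the bicategorical triangle identities to the fibrewise ones, in both directions
    ([transfer_triangle_l], [transfer_triangle_r]), so duals of [M] and right duals of
    [hat M] determine each other ([hat_right_dualizable], [dual_of_hat_dual]).  It also
    carries the bicategorical trace, evaluated on the class of the unit element, to the
    fibrewise trace for the corresponding dual ([transfer_trace]).  The class of the unit
    element is precisely the morphism [unit_to_shadow] ([unit_to_shadow_elt]).  The dual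
    that corresponds to a given right dual need not be the given dual of [M], but the
    fibrewise trace is the same for both ([sm_endo_trace_unique]). *)

Set Implicit Arguments.
Unset Strict Implicit.
Unset Printing Implicit Defensive.

(* Rewriting up to conversion would find compositions inside the definitions of composite
   isomorphisms; the syntactic matching of these two leaves such isomorphisms folded. *)
Ltac ra := rewrite <- ?comp_assoc.
Tactic Notation "la" := rewrite -> ?comp_assoc.

(** * Cancelling isomorphisms *)

Section Categories.
Context {K : Category}.

Lemma comp_pre {w x y z : K} {g : y ⟶ z} {f : x ⟶ y} {k : x ⟶ z} :
  g ∘ f = k -> forall u : w ⟶ x, g ∘ (f ∘ u) = k ∘ u.
Proof. by move=> <- u; rewrite comp_assoc. Qed.

Lemma comp_sq {w x y y' z : K} {g : y ⟶ z} {f : x ⟶ y} {g' : y' ⟶ z} {f' : x ⟶ y'} :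
  g ∘ f = g' ∘ f' -> forall u : w ⟶ x, g ∘ (f ∘ u) = g' ∘ (f' ∘ u).
Proof. by move=> E u; rewrite !comp_assoc E. Qed.

Lemma fwd_bwd_comp {w x y : K} (i : Iso x y) (u : w ⟶ y) : i ∘ (bwd i ∘ u) = u.
Proof. by rewrite comp_assoc fwd_bwd comp_idl. Qed.

Lemma bwd_fwd_comp {w x y : K} (i : Iso x y) (u : w ⟶ x) : bwd i ∘ (i ∘ u) = u.
Proof. by rewrite comp_assoc bwd_fwd comp_idl. Qed.

Lemma fwd_inj {w x y : K} (i : Iso x y) (u v : w ⟶ x) : i ∘ u = i ∘ v -> u = v.
Proof. by move=> E; rewrite -(bwd_fwd_comp i u) E bwd_fwd_comp. Qed.

Lemma bwd_eq {w x y : K} (i : Iso x y) (u : w ⟶ x) (v : w ⟶ y) :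
  i ∘ u = v -> bwd i ∘ v = u.
Proof. by move=> <-; rewrite bwd_fwd_comp. Qed.

Lemma iso_epi {x y z : K} (i : Iso x y) (f g : y ⟶ z) :
  f ∘ i = g ∘ i -> f = g.
Proof.
  by move=> E; rewrite -(comp_idr f) -(comp_idr g) -(fwd_bwd i) !comp_assoc E.
Qed.

Lemma isiso_comp {x y z : K} (g : y ⟶ z) (f : x ⟶ y) :
  IsIso g -> IsIso f -> IsIso (g ∘ f).
Proof.
  move=> [g' E1 E2] [f' E3 E4]; exists (f' ∘ g').
  - by rewrite cancel_mid.
  - by rewrite cancel_mid.
Qed.

Lemma isiso_fwd {x y : K} (i : Iso x y) : IsIso i.
Proof. exact: (Build_IsIso (fwd_bwd i) (bwd_fwd i)). Qed.

End Categories.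

Lemma fmap_bwd_eq {K K' : Category} (F : Functor K K') {x y : K} {w : K'} (i : Iso x y)
    (u : w ⟶ F x) (v : w ⟶ F y) :
  fmap F i ∘ u = v -> fmap F (bwd i) ∘ v = u.
Proof. move=> E; exact: (bwd_eq (i := fmap_iso F i) E). Qed.

Lemma isiso_fmap {K K' : Category} (F : Functor K K') {x y : K} (f : x ⟶ y) :
  IsIso f -> IsIso (fmap F f).
Proof. move=> i; exact: (isiso_fwd (fmap_iso F (iso_of i))). Qed.

Lemma isiso_tmap {V : SymMonCat} {x x' y y' : V} (f : x ⟶ x') (g : y ⟶ y') :
  IsIso f -> IsIso g -> IsIso (f ⊗₁ g).
Proof. move=> i j; exact: (isiso_fwd (tens_iso (iso_of i) (iso_of j))). Qed.

(** * Morphisms over a morphism of the base *)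

Section Over.
Context {S : Category} {C : IndexedSMC S}.
Local Notation "f ^*" := (reidx C f) (at level 2, left associativity, format "f ^*").

(** A morphism [X ⟶ h^* M] is a morphism [X → M] over [h] in the total category of the
    indexed category.  When [h = g ∘ f], this is its factorization through the cartesian
    morphism [g^* M → M].  Composites in the base are always given together with a
    proof [e] of their value: this absorbs the coherence of the pseudofunctor, which would
    otherwise appear as transports between [(h ∘ g) ∘ f] and [h ∘ (g ∘ f)]. *)
Definition lift {T A B : S} {f : T ⟶ A} {g : A ⟶ B} {h : T ⟶ B} (e : g ∘ f = h)
    {X : fib C T} {M : fib C B} (u : X ⟶ h^* M) : X ⟶ f^* (g^* M) :=
  bwd (reidx_tri e M) ∘ u.

(** Composition in the total category. *)
Definition over_comp {T A B : S} {f : T ⟶ A} {g : A ⟶ B} {h : T ⟶ B} (e : g ∘ f = h)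
    {X : fib C T} {Y : fib C A} {Z : fib C B} (v : Y ⟶ g^* Z) (u : X ⟶ f^* Y) :
    X ⟶ h^* Z :=
  reidx_tri e Z ∘ (fmap (f^*) v ∘ u).

Lemma reidx_eq_cancel {T A : S} {f g : T ⟶ A} (e : f = g) (e' : g = f)
    {M : fib C A} {X : fib C T} (u : X ⟶ g^* M) :
  reidx_eq e M ∘ (reidx_eq e' M ∘ u) = u.
Proof.
  destruct e; rewrite (proof_irrelevance _ e' eq_refl) /= !comp_idl; reflexivity.
Qed.

(** The coherence axiom of the pseudofunctor for arbitrary values of the composites.
    Proof irrelevance makes the choice of the base equations immaterial. *)
Lemma reidx_tri_assoc {T A B D : S} {f : T ⟶ A} {g : A ⟶ B} {h : B ⟶ D}
    {p : T ⟶ B} {q : A ⟶ D} {k : T ⟶ D}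
    (e1 : g ∘ f = p) (e2 : h ∘ p = k) (e3 : h ∘ g = q) (e4 : q ∘ f = k) (M : fib C D) :
  reidx_tri e4 M ∘ fmap (f^*) (reidx_tri e3 M)
  = reidx_tri e2 M ∘ reidx_tri e1 (h^* M).
Proof.
  destruct e1, e3, e2.
  rewrite /reidx_tri /reidx_eq /= !comp_idl.
  rewrite -comp_assoc reidx_assoc.
  rewrite -!(comp_assoc (c := fib C T)). exact: reidx_eq_cancel.
Qed.

Lemma reidx_tri_mu {T A B : S} {f : T ⟶ A} {g : A ⟶ B} {h : T ⟶ B} (e : g ∘ f = h)
    (M N : fib C B) :
  reidx_tri e (M ⊗ N) ∘ (fmap (f^*) (smf_mu (g^*) M N) ∘ smf_mu (f^*) _ _)
  = smf_mu (h^*) M N ∘ (reidx_tri e M ⊗₁ reidx_tri e N).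
Proof.
  destruct e; rewrite /reidx_tri /reidx_eq /= !comp_idl.
  exact: (mni_mu (reidx_comp C f g) M N).
Qed.

Lemma reidx_tri_eps {T A B : S} {f : T ⟶ A} {g : A ⟶ B} {h : T ⟶ B} (e : g ∘ f = h) :
  reidx_tri e munit ∘ (fmap (f^*) (smf_eps (g^*)) ∘ smf_eps (f^*)) = smf_eps (h^*).
Proof.
  destruct e; rewrite /reidx_tri /reidx_eq /= !comp_idl.
  exact: (mni_eps (reidx_comp C f g)).
Qed.

Lemma tri_refl {T A B : S} (f : T ⟶ A) (g : A ⟶ B) (M : fib C B) :
  fwd (reidx_tri (erefl (g ∘ f)) M) = reidx_comp C f g M.
Proof. by rewrite /reidx_tri /reidx_eq /= comp_idl. Qed.

Lemma bwd_tri_refl {T A B : S} (f : T ⟶ A) (g : A ⟶ B) (M : fib C B) :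
  bwd (reidx_tri (erefl (g ∘ f)) M) = bwd (reidx_comp C f g M).
Proof. by rewrite /reidx_tri /reidx_eq /= comp_idr. Qed.

Lemma reidx_sq_tri {T A B D : S} {f : T ⟶ A} {g : A ⟶ D} {h : T ⟶ B} {k : B ⟶ D}
    (e : g ∘ f = k ∘ h) {X : fib C T} {M : fib C D} (u : X ⟶ h^* (k^* M)) :
  bwd (reidx_sq e M) ∘ u = lift e (reidx_tri erefl M ∘ u).
Proof.
  by rewrite /reidx_sq /lift /reidx_tri /reidx_eq /= comp_idl !comp_assoc.
Qed.

Section Lift.
Context {T A B : S} {f : T ⟶ A} {g : A ⟶ B} {h : T ⟶ B}.

Lemma tri_lift (e : g ∘ f = h) {X : fib C T} {M : fib C B} (u : X ⟶ h^* M) :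
  reidx_tri e M ∘ lift e u = u.
Proof. exact: fwd_bwd_comp. Qed.

Lemma lift_tri (e : g ∘ f = h) {X : fib C T} {M : fib C B} (u : X ⟶ f^* (g^* M)) :
  lift e (reidx_tri e M ∘ u) = u.
Proof. exact: bwd_fwd_comp. Qed.

Lemma lift_eq (e e' : g ∘ f = h) {X : fib C T} {M : fib C B} (u : X ⟶ h^* M) :
  lift e u = lift e' u.
Proof. by rewrite (proof_irrelevance _ e e'). Qed.

Lemma lift_pre (e : g ∘ f = h) {X X' : fib C T} {M : fib C B} (u : X ⟶ h^* M)
  (w : X' ⟶ X) : lift e u ∘ w = lift e (u ∘ w).
Proof. by rewrite /lift comp_assoc. Qed.

Lemma lift_post (e : g ∘ f = h) {X : fib C T} {M N : fib C B} (u : X ⟶ h^* M)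
    (w : M ⟶ N) :
  fmap (f^*) (fmap (g^*) w) ∘ lift e u = lift e (fmap (h^*) w ∘ u).
Proof.
  apply: (fwd_inj (i := reidx_tri e N)).
  by rewrite (comp_sq (reidx_tri_nat e w)) !tri_lift.
Qed.

Lemma over_comp_pre (e : g ∘ f = h) {X X' : fib C T} {Y : fib C A} {Z : fib C B}
  (v : Y ⟶ g^* Z) (u : X ⟶ f^* Y) (w : X' ⟶ X) :
  over_comp e v u ∘ w = over_comp e v (u ∘ w).
Proof. rewrite /over_comp; ra; by []. Qed.

Lemma over_comp_post (e : g ∘ f = h) {X : fib C T} {Y : fib C A} {Z Z' : fib C B}
  (v : Y ⟶ g^* Z) (u : X ⟶ f^* Y) (w : Z ⟶ Z') :
  fmap (h^*) w ∘ over_comp e v u = over_comp e (fmap (g^*) w ∘ v) u.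
Proof.
  rewrite /over_comp fmap_comp; ra; by rewrite -(comp_sq (reidx_tri_nat e w)).
Qed.

Lemma over_comp_mid (e : g ∘ f = h) {X : fib C T} {Y Y' : fib C A} {Z : fib C B}
  (v : Y' ⟶ g^* Z) (w : Y ⟶ Y') (u : X ⟶ f^* Y) :
  over_comp e v (fmap (f^*) w ∘ u) = over_comp e (v ∘ w) u.
Proof. rewrite /over_comp fmap_comp; ra; by []. Qed.

End Lift.

(** Factorizing commutes with precomposition, since factorizations through a cartesian
    morphism are unique. *)
Lemma over_comp_lift {T A B D : S} {f : T ⟶ A} {g : A ⟶ B} {h : B ⟶ D}
    {p : T ⟶ B} {q : A ⟶ D} {k : T ⟶ D}
    (e1 : g ∘ f = p) (e2 : h ∘ p = k) (e3 : h ∘ g = q) (e4 : q ∘ f = k)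
    {X : fib C T} {Y : fib C A} {Z : fib C D} (v : Y ⟶ q^* Z) (u : X ⟶ f^* Y) :
  over_comp e1 (lift e3 v) u = lift e2 (over_comp e4 v u).
Proof.
  apply: (fwd_inj (i := reidx_tri e2 Z)).
  rewrite tri_lift /over_comp; la; rewrite -(reidx_tri_assoc e1 e2 e3 e4).
  ra; by rewrite (comp_pre (esym (fmap_comp _ _ _))) tri_lift.
Qed.

Lemma over_comp_tri {T A B D : S} {f : T ⟶ A} {g : A ⟶ B} {h : B ⟶ D}
    {p : T ⟶ B} {q : A ⟶ D} {k : T ⟶ D}
    (e1 : g ∘ f = p) (e2 : h ∘ p = k) (e3 : h ∘ g = q) (e4 : q ∘ f = k)
    {X : fib C T} {Y : fib C A} {Z : fib C D} (v : Y ⟶ g^* (h^* Z)) (u : X ⟶ f^* Y) :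
  reidx_tri e2 Z ∘ over_comp e1 v u = over_comp e4 (reidx_tri e3 Z ∘ v) u.
Proof.
  rewrite /over_comp fmap_comp; la.
  by rewrite -(reidx_tri_assoc e1 e2 e3 e4).
Qed.

Lemma lift_lift {T A B D : S} {f : T ⟶ A} {g : A ⟶ B} {h : B ⟶ D}
    {p : T ⟶ B} {q : A ⟶ D} {k : T ⟶ D}
    (e1 : g ∘ f = p) (e2 : h ∘ p = k) (e3 : h ∘ g = q) (e4 : q ∘ f = k)
    {X : fib C T} {M : fib C D} (u : X ⟶ k^* M) :
  fmap (f^*) (reidx_tri e3 M) ∘ lift e1 (lift e2 u) = lift e4 u.
Proof.
  apply: (fwd_inj (i := reidx_tri e4 M)).
  by rewrite (comp_sq (reidx_tri_assoc e1 e2 e3 e4 M)) !tri_lift.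
Qed.

Lemma lift_sq {T A B B' D : S} {s : T ⟶ A} {f : A ⟶ B} {g : B ⟶ D} {h : A ⟶ B'}
    {k : B' ⟶ D} {p : T ⟶ B} {p' : T ⟶ B'} {t : T ⟶ D} (e : g ∘ f = k ∘ h)
    (e1 : f ∘ s = p) (e2 : g ∘ p = t) (e3 : h ∘ s = p') (e4 : k ∘ p' = t)
    {X : fib C T} {M : fib C D} (u : X ⟶ t^* M) :
  fmap (s^*) (reidx_sq e M) ∘ lift e1 (lift e2 u) = lift e3 (lift e4 u).
Proof.
  have e5 : (k ∘ h) ∘ s = t by rewrite -comp_assoc e3.
  rewrite /reidx_sq. cbn [fwd iso_comp inv].
  rewrite fmap_comp -comp_assoc (lift_lift e1 e2 e e5).
  by apply: fmap_bwd_eq; rewrite -tri_refl (lift_lift e3 e4 erefl e5).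
Qed.

Lemma over_comp_assoc {T A B D : S} {f : T ⟶ A} {g : A ⟶ B} {h : B ⟶ D}
    {p : T ⟶ B} {q : A ⟶ D} {k : T ⟶ D}
    (e1 : g ∘ f = p) (e2 : h ∘ p = k) (e3 : h ∘ g = q) (e4 : q ∘ f = k)
    {X : fib C T} {Y : fib C A} {Z : fib C B} {W : fib C D}
    (w : Z ⟶ h^* W) (v : Y ⟶ g^* Z) (u : X ⟶ f^* Y) :
  over_comp e2 w (over_comp e1 v u) = over_comp e4 (over_comp e3 w v) u.
Proof.
  rewrite {1}/over_comp (over_comp_post e1 v u w) (over_comp_tri e1 e2 e3 e4).
  by [].
Qed.

(** The action of the reindexing functor is recovered from total composition; used to bring
    a morphism [fmap f^* v], with [v] built from cartesian data, into a form to which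
    [box_elt_comp] applies. *)
Lemma over_comp_def {T A B : S} {f : T ⟶ A} {g : A ⟶ B} {h : T ⟶ B} (e : g ∘ f = h)
    {X : fib C T} {Y : fib C A} {Z : fib C B} (v : Y ⟶ g^* Z) (u : X ⟶ f^* Y) :
  fmap (f^*) v ∘ u = lift e (over_comp e v u).
Proof. by rewrite /over_comp lift_tri. Qed.

Lemma over_comp_idm {T A B : S} {f : T ⟶ A} {g : A ⟶ B} {h : T ⟶ B} (e : g ∘ f = h)
    {X : fib C T} {Z : fib C B} (u : X ⟶ f^* (g^* Z)) :
  over_comp e (idm _) u = reidx_tri e Z ∘ u.
Proof. by rewrite /over_comp fmap_id comp_idl. Qed.

Lemma over_comp_idl {T A : S} {f : T ⟶ A} (e : idm A ∘ f = f)
    {X : fib C T} {Y Z : fib C A} (w : Y ⟶ Z) (u : X ⟶ f^* Y) :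
  over_comp e (reidx_id C A Z ∘ w) u = fmap (f^*) w ∘ u.
Proof.
  have H : reidx_tri e Z ∘ fmap (f^*) (reidx_id C A Z) = idm _.
  { rewrite (proof_irrelevance _ e (comp_idl f)). exact: reidx_unit_l. }
  rewrite /over_comp fmap_comp; ra; by rewrite (comp_pre H) comp_idl.
Qed.

Lemma lift_idr {T A : S} {f : T ⟶ A} (e : f ∘ idm T = f) {X : fib C T} {M : fib C A}
    (u : X ⟶ f^* M) : lift e u = reidx_id C T (f^* M) ∘ u.
Proof.
  apply: (fwd_inj (i := reidx_tri e M)).
  rewrite tri_lift (proof_irrelevance _ e (comp_idr f)) comp_assoc.
  rewrite (_ : reidx_tri _ _ ∘ _ = idm _) ?comp_idl //.
  exact: reidx_unit_r.
Qed.

Lemma over_comp_idr {T A : S} {f : T ⟶ A} (e : f ∘ idm T = f) {X Y : fib C T} {M : fib C A}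
    (v : Y ⟶ f^* M) (u : X ⟶ Y) : over_comp e v (reidx_id C T Y ∘ u) = v ∘ u.
Proof.
  apply: (fwd_inj (i := inv (reidx_tri e M))); rewrite [LHS]lift_tri.
  rewrite [RHS](lift_idr e) comp_assoc comp_assoc.
  by rewrite (mni_nat (reidx_id C T)).
Qed.

(** The tensor product of two morphisms of the total category over the same base morphism. *)
Definition over_tens {T A : S} {f : T ⟶ A} {X Y : fib C T} {M N : fib C A}
    (u : X ⟶ f^* M) (v : Y ⟶ f^* N) : X ⊗ Y ⟶ f^* (M ⊗ N) :=
  smf_mu (f^*) M N ∘ (u ⊗₁ v).

Lemma over_tens_post {T A : S} {f : T ⟶ A} {X Y : fib C T} {M N M' N' : fib C A}
    (u : X ⟶ f^* M) (v : Y ⟶ f^* N) (i : M ⟶ M') (j : N ⟶ N') :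
  fmap (f^*) (i ⊗₁ j) ∘ over_tens u v = over_tens (fmap (f^*) i ∘ u) (fmap (f^*) j ∘ v).
Proof.
  by rewrite /over_tens tmap_comp comp_assoc -smf_mu_nat -comp_assoc.
Qed.

Lemma over_tens_pre {T A : S} {f : T ⟶ A} {X Y X' Y' : fib C T} {M N : fib C A}
    (u : X ⟶ f^* M) (v : Y ⟶ f^* N) (i : X' ⟶ X) (j : Y' ⟶ Y) :
  over_tens u v ∘ (i ⊗₁ j) = over_tens (u ∘ i) (v ∘ j).
Proof. by rewrite /over_tens tmap_comp comp_assoc. Qed.

Lemma over_comp_tens {T A B : S} {f : T ⟶ A} {g : A ⟶ B} {h : T ⟶ B} (e : g ∘ f = h)
    {X X' : fib C T} {Y Y' : fib C A} {Z Z' : fib C B}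
    (v : Y ⟶ g^* Z) (v' : Y' ⟶ g^* Z') (u : X ⟶ f^* Y) (u' : X' ⟶ f^* Y') :
  over_comp e (over_tens v v') (over_tens u u')
  = over_tens (over_comp e v u) (over_comp e v' u').
Proof.
  rewrite /over_comp {1}/over_tens fmap_comp -comp_assoc over_tens_post.
  rewrite /over_tens (comp_assoc (fmap _ _)) comp_assoc reidx_tri_mu !tmap_comp.
  by la.
Qed.

Lemma mu_lift {T A B : S} {f : T ⟶ A} {g : A ⟶ B} {h : T ⟶ B} (e : g ∘ f = h)
    {X Y : fib C T} {M N : fib C B} (u : X ⟶ h^* M) (v : Y ⟶ h^* N) :
  fmap (f^*) (smf_mu (g^*) M N) ∘ over_tens (lift e u) (lift e v) = lift e (over_tens u v).
Proof.
  apply: (fwd_inj (i := reidx_tri e _)).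
  by rewrite tri_lift /over_tens (comp_assoc (fmap _ _)) comp_assoc reidx_tri_mu
    -comp_assoc -tmap_comp !tri_lift.
Qed.

Lemma over_tens_assoc {T A : S} {f : T ⟶ A} {X Y Z : fib C T} {M N L : fib C A}
    (u : X ⟶ f^* M) (v : Y ⟶ f^* N) (w : Z ⟶ f^* L) :
  fmap (f^*) (assoc M N L) ∘ over_tens (over_tens u v) w
  = over_tens u (over_tens v w) ∘ assoc X Y Z.
Proof.
  rewrite /over_tens -{1}(comp_idl w) tmap_comp -(comp_idl u) tmap_comp comp_idl.
  ra; rewrite -assoc_nat; la. congr (_ ∘ _).
  by rewrite -smf_assoc.
Qed.

Lemma over_tens_braid {T A : S} {f : T ⟶ A} {X Y : fib C T} {M N : fib C A}
    (u : X ⟶ f^* M) (v : Y ⟶ f^* N) :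
  fmap (f^*) (braid M N) ∘ over_tens u v = over_tens v u ∘ braid X Y.
Proof.
  rewrite /over_tens comp_assoc smf_braid; ra; by rewrite braid_nat.
Qed.

Lemma over_tens_lunit {T A : S} {f : T ⟶ A} {X : fib C T} {M : fib C A} (u : X ⟶ f^* M) :
  fmap (f^*) (lunit M) ∘ over_tens (smf_eps (f^*)) u = u ∘ lunit X.
Proof.
  rewrite /over_tens -(comp_idr (fwd (smf_eps _))) -{1}(comp_idl u) tmap_comp; la.
  by rewrite smf_lunit lunit_nat.
Qed.

Lemma over_tens_runit {T A : S} {f : T ⟶ A} {X : fib C T} {M : fib C A} (u : X ⟶ f^* M) :
  fmap (f^*) (runit M) ∘ over_tens u (smf_eps (f^*)) = u ∘ runit X.
Proof.
  rewrite /over_tens -(comp_idr (fwd (smf_eps _))) -{1}(comp_idl u) tmap_comp; la.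
  by rewrite smf_runit runit_nat.
Qed.

Lemma isiso_lift {T A B : S} {f : T ⟶ A} {g : A ⟶ B} {h : T ⟶ B} (e : g ∘ f = h)
    {X : fib C T} {M : fib C B} (u : X ⟶ h^* M) : IsIso u -> IsIso (lift e u).
Proof. move=> i; apply: isiso_comp i; exact: (isiso_fwd (inv (reidx_tri e M))). Qed.

Lemma isiso_over_comp {T A B : S} {f : T ⟶ A} {g : A ⟶ B} {h : T ⟶ B} (e : g ∘ f = h)
    {X : fib C T} {Y : fib C A} {Z : fib C B} (v : Y ⟶ g^* Z) (u : X ⟶ f^* Y) :
  IsIso v -> IsIso u -> IsIso (over_comp e v u).
Proof.
  move=> i j; apply: isiso_comp; first exact: isiso_fwd.
  by apply: isiso_comp j; apply: isiso_fmap.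
Qed.

(** [s^*] is an equivalence when [s] is invertible, so a morphism over [t = h ∘ s] extends
    along an isomorphism [z] over [s]. *)
Lemma over_extend {T A B : S} {s : T ⟶ A} {k : A ⟶ T} (e1 : k ∘ s = idm T)
    (e2 : s ∘ k = idm A) {h : A ⟶ B} {t : T ⟶ B} (e : h ∘ s = t)
    {X : fib C T} {Y : fib C A} {Z : fib C B} (z : X ⟶ s^* Y) (g : X ⟶ t^* Z) :
  IsIso z -> exists w : Y ⟶ h^* Z, over_comp e w z = g.
Proof.
  move=> [z' E1 E2].
  have e3 : t ∘ k = h by rewrite -e -comp_assoc e2 comp_idr.
  have e4 : t ∘ idm T = t by apply: comp_idr.
  have e5 : s ∘ idm T = s by apply: comp_idr.
  have e6 : idm A ∘ s = s by apply: comp_idl.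
  (* [Y ≅ k^* s^* Y ≅ k^* X] is the inverse of [z], as a morphism over [k]. *)
  exists (over_comp e3 g (fmap (k^*) z' ∘ lift e2 (reidx_id C A Y))).
  rewrite -(over_comp_assoc e1 e4 e3 e).
  have -> : over_comp e1 (fmap (k^*) z' ∘ lift e2 (reidx_id C A Y)) z = reidx_id C T X ∘ idm X.
  { rewrite -over_comp_post (over_comp_lift e1 e5 e2 e6) lift_idr.
    rewrite -[X in over_comp e6 X](comp_idr (fwd (reidx_id C A Y))) over_comp_idl.
    rewrite fmap_id comp_idl (comp_sq (esym (mni_nat (reidx_id C T) z'))) /= E2.
    by []. }
  by rewrite over_comp_idr comp_idr.
Qed.

Lemma reidx_faithful {A B : S} {s : A ⟶ B} {k : B ⟶ A} (e : s ∘ k = idm B)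
    {X Y : fib C B} (u v : X ⟶ Y) : fmap (s^*) u = fmap (s^*) v -> u = v.
Proof.
  move=> E; apply: (iso_epi (i := reidx_inverse e X)).
  by rewrite -!reidx_inverse_nat E.
Qed.

(** Lets a triangle identity in a fibre be read off from, and imply, the one for 1-cells
    when [i] exhibits the 1-cell as an object of the fibre. *)
Lemma transfer_idm {A B : S} {s : A ⟶ B} {k : B ⟶ A} (e : s ∘ k = idm B)
    {X : fib C A} {Y : fib C B} (i : Iso X (s^* Y)) (u : Y ⟶ Y) (v : X ⟶ X) :
  fmap (s^*) u ∘ i = i ∘ v -> (u = idm _ <-> v = idm _).
Proof.
  move=> E; split=> E'.
  - by apply: (fwd_inj (i := i)); rewrite -E E' fmap_id comp_idl comp_idr.
  - apply: (reidx_faithful e); apply: (iso_epi (i := i)).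
    by rewrite E E' fmap_id comp_idl comp_idr.
Qed.

End Over.

(** * Independence of the symmetric monoidal trace from the dual *)

Section SymmetricMonoidalTraces.
Context {V : SymMonCat}.
Local Notation "1" := (idm _).

Lemma tmap_l {x y z : V} (w : V) (g : y ⟶ z) (f : x ⟶ y) :
  (g ∘ f) ⊗₁ idm w = (g ⊗₁ idm w) ∘ (f ⊗₁ idm w).
Proof. by rewrite -tmap_comp comp_idl. Qed.

Lemma tmap_r {x y z : V} (w : V) (g : y ⟶ z) (f : x ⟶ y) :
  idm w ⊗₁ (g ∘ f) = (idm w ⊗₁ g) ∘ (idm w ⊗₁ f).
Proof. by rewrite -tmap_comp comp_idl. Qed.

Lemma tmap_swap {x x' y y' : V} (f : x ⟶ x') (g : y ⟶ y') :
  (f ⊗₁ 1) ∘ (1 ⊗₁ g) = (1 ⊗₁ g) ∘ (f ⊗₁ 1).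
Proof. by rewrite -!tmap_comp !comp_idl !comp_idr. Qed.

Lemma munit_tens_faithful {x y : V} (f g : x ⟶ y) :
  idm munit ⊗₁ f = idm munit ⊗₁ g -> f = g.
Proof.
  move=> E; rewrite -(comp_idr f) -(comp_idr g) -(fwd_bwd (lunit x)) !comp_assoc.
  by rewrite -!lunit_nat E.
Qed.

Lemma tens_munit_faithful {x y : V} (f g : x ⟶ y) :
  f ⊗₁ idm munit = g ⊗₁ idm munit -> f = g.
Proof.
  move=> E; rewrite -(comp_idr f) -(comp_idr g) -(fwd_bwd (runit x)) !comp_assoc.
  by rewrite -!runit_nat E.
Qed.

Lemma assoc_nat1 {x x' : V} (y z : V) (f : x ⟶ x') :
  assoc x' y z ∘ ((f ⊗₁ 1) ⊗₁ 1) = (f ⊗₁ 1) ∘ assoc x y z.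
Proof. by rewrite assoc_nat tmap_id. Qed.

Lemma assoc_nat2 {y y' : V} (x z : V) (f : y ⟶ y') :
  assoc x y' z ∘ ((1 ⊗₁ f) ⊗₁ 1) = (1 ⊗₁ (f ⊗₁ 1)) ∘ assoc x y z.
Proof. by rewrite assoc_nat. Qed.

Lemma assoc_nat3 {z z' : V} (x y : V) (f : z ⟶ z') :
  assoc x y z' ∘ (1 ⊗₁ f) = (1 ⊗₁ (1 ⊗₁ f)) ∘ assoc x y z.
Proof. by rewrite -assoc_nat tmap_id. Qed.

(** Kelly's redundant unit axioms, here and in the next two lemmas: tensoring with
    [munit] is faithful, and after it the claims follow from the pentagon and the triangle. *)
Lemma assoc_lunit (x y : V) : lunit (x ⊗ y) ∘ assoc munit x y = lunit x ⊗₁ idm y.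
Proof.
  apply: munit_tens_faithful; rewrite tmap_r.
  apply: (iso_epi (i := assoc munit (munit ⊗ x) y)).
  apply: (iso_epi (i := tens_iso (assoc munit munit x) (iso_id y))).
  cbn [fwd tens_iso iso_id].
  rewrite -(assoc_nat2 munit y) -[RHS]comp_assoc -tmap_l triangle assoc_nat1.
  rewrite -triangle -[RHS]comp_assoc pentagon.
  by ra.
Qed.

Lemma assoc_runit (x y : V) : (idm x ⊗₁ runit y) ∘ assoc x y munit = runit (x ⊗ y).
Proof.
  apply: tens_munit_faithful; rewrite tmap_l.
  apply: (fwd_inj (i := assoc x y munit)).
  rewrite comp_assoc assoc_nat2 -(triangle (x ⊗ y)) -triangle tmap_r.
  rewrite (comp_assoc (assoc x y munit)) (assoc_nat3 x y).
  by rewrite -[RHS]comp_assoc pentagon; ra.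
Qed.

Lemma lunit_runit_munit : fwd (lunit (munit : V)) = runit munit.
Proof.
  apply: tens_munit_faithful; rewrite -assoc_lunit -triangle; congr (_ ∘ _).
  by apply: (fwd_inj (i := lunit munit)); rewrite lunit_nat.
Qed.

Lemma lunit_bwd_nat {x y : V} (f : x ⟶ y) :
  bwd (lunit y) ∘ f = (1 ⊗₁ f) ∘ bwd (lunit x).
Proof. by apply: inv_nat; rewrite lunit_nat. Qed.

Lemma runit_bwd_nat {x y : V} (f : x ⟶ y) :
  (f ⊗₁ 1) ∘ bwd (runit x) = bwd (runit y) ∘ f.
Proof. by symmetry; apply: inv_nat; rewrite runit_nat. Qed.

Lemma lunit_runit_bwd : bwd (lunit (munit : V)) = bwd (runit munit).
Proof.
  rewrite -[LHS]comp_idr -(fwd_bwd (runit munit)) -lunit_runit_munit.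
  by rewrite bwd_fwd_comp.
Qed.

Lemma assoc_lunit_bwd (x y : V) :
  assoc munit x y ∘ (bwd (lunit x) ⊗₁ 1) = bwd (lunit (x ⊗ y)).
Proof.
  apply: (fwd_inj (i := lunit (x ⊗ y))).
  by rewrite comp_assoc assoc_lunit -tmap_l !fwd_bwd tmap_id.
Qed.

Lemma assoc_runit_bwd (x y : V) :
  bwd (runit (x ⊗ y)) = bwd (assoc x y munit) ∘ (1 ⊗₁ bwd (runit y)).
Proof.
  apply: (fwd_inj (i := runit (x ⊗ y))).
  rewrite fwd_bwd -assoc_runit -comp_assoc fwd_bwd_comp -tmap_r fwd_bwd.
  by rewrite tmap_id.
Qed.

Lemma assoc_bwd_nat2 {y y' : V} (x z : V) (f : y ⟶ y') :
  bwd (assoc x y' z) ∘ (1 ⊗₁ (f ⊗₁ 1)) = ((1 ⊗₁ f) ⊗₁ 1) ∘ bwd (assoc x y z).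
Proof. by apply: inv_nat; rewrite assoc_nat2. Qed.

Lemma assoc_bwd_nat3 {z z' : V} (x y : V) (f : z ⟶ z') :
  bwd (assoc x y z') ∘ (1 ⊗₁ (1 ⊗₁ f)) = (1 ⊗₁ f) ∘ bwd (assoc x y z).
Proof. by apply: inv_nat; rewrite assoc_nat3. Qed.

Lemma triangle_bwd (x y : V) :
  (runit x ⊗₁ 1) ∘ bwd (assoc x munit y) = 1 ⊗₁ lunit y.
Proof. by rewrite -triangle -comp_assoc fwd_bwd comp_idr. Qed.

Lemma triangle_bwd_r (x y : V) :
  bwd (runit x) ⊗₁ 1 = bwd (assoc x munit y) ∘ (1 ⊗₁ bwd (lunit y)).
Proof.
  symmetry; apply: bwd_eq.
  apply: (fwd_inj (i := tens_iso (iso_id x) (lunit y))); cbn [fwd tens_iso iso_id].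
  by rewrite comp_assoc triangle -tmap_l -tmap_r !fwd_bwd !tmap_id.
Qed.

(** The pentagon solved for the composite that arises when [mate] is composed with a
    coevaluation. *)
Lemma pentagon_bwd_l (w x y z : V) :
  (assoc w x y ⊗₁ 1) ∘ (bwd (assoc (w ⊗ x) y z) ∘ bwd (assoc w x (y ⊗ z)))
  = bwd (assoc w (x ⊗ y) z) ∘ (1 ⊗₁ bwd (assoc x y z)).
Proof.
  symmetry; apply: bwd_eq.
  apply: (fwd_inj (i := tens_iso (iso_id w) (assoc x y z))).
  cbn [fwd tens_iso iso_id].
  rewrite -tmap_r fwd_bwd tmap_id !comp_assoc -pentagon.
  by rewrite -comp_assoc -(comp_assoc (assoc w x _)) fwd_bwd_comp fwd_bwd.
Qed.

(** The unit objects that enter the general trace through [Q] and [P] cancel. *)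
Lemma sm_endo_trace_loop {M : V} (D : Dual M) (f : M ⟶ M) :
  sm_endo_trace D f = ev D ∘ braid M (dual D) ∘ (f ⊗₁ 1) ∘ coev D.
Proof.
  have E1 : lunit munit ∘ (ev D ⊗₁ 1) ∘ inv (assoc (dual D) M munit)
            ∘ braid (M ⊗ munit) (dual D) ∘ (bwd (runit M) ⊗₁ 1)
            = ev D ∘ braid M (dual D).
  { rewrite lunit_runit_munit runit_nat -assoc_runit; ra; congr (_ ∘ _).
    rewrite fwd_bwd_comp comp_assoc -braid_nat -comp_assoc -tmap_l fwd_bwd tmap_id.
    by rewrite comp_idr. }
  have E2 : (lunit M ⊗₁ 1) ∘ inv (assoc munit M (dual D)) ∘ (1 ⊗₁ coev D)
            ∘ inv (runit munit) = coev D.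
  { rewrite -assoc_lunit; ra. cbn [fwd inv]. rewrite fwd_bwd_comp comp_assoc lunit_nat.
    by rewrite lunit_runit_munit -comp_assoc fwd_bwd comp_idr. }
  rewrite /sm_endo_trace /sm_trace -{2}E2 -E1 !tmap_l.
  by ra.
Qed.

Section Mate.
Context {M : V} (D D' : Dual M).

(** The comparison of two duals: create [M ⊗ dual D'] with the second coevaluation and
    annihilate [dual D ⊗ M] with the first evaluation. *)
Definition mate : dual D ⟶ dual D' :=
  lunit (dual D') ∘ (ev D ⊗₁ 1) ∘ bwd (assoc (dual D) M (dual D')) ∘ (1 ⊗₁ coev D')
  ∘ bwd (runit (dual D)).

(** The composite contains the zigzag of [D] on [M], tensored with [dual D'] and applied
    to [coev D']. *)
Lemma mate_coev : (1 ⊗₁ mate) ∘ coev D = coev D'.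
Proof.
  (* The two coevaluations are created in either order. *)
  have R : ((coev D ⊗₁ 1) ⊗₁ 1) ∘ ((bwd (lunit M) ⊗₁ 1) ∘ coev D')
           = bwd (assoc (M ⊗ dual D) M (dual D'))
             ∘ ((1 ⊗₁ coev D') ∘ (bwd (runit (M ⊗ dual D)) ∘ coev D)).
  { symmetry; apply: bwd_eq.
    rewrite (comp_sq (assoc_nat1 _ _ _)).
    have -> : assoc munit M (dual D') ∘ ((bwd (lunit M) ⊗₁ 1) ∘ coev D')
              = (1 ⊗₁ coev D') ∘ bwd (lunit munit).
    { by rewrite -lunit_bwd_nat -assoc_lunit_bwd comp_assoc. }
    by rewrite comp_assoc tmap_swap lunit_runit_bwd -comp_assoc runit_bwd_nat. }
  rewrite -[RHS]comp_idl -tmap_id -{2}(dual_triangle_l D) !tmap_l; ra. cbn [fwd inv].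
  rewrite R assoc_runit_bwd /mate !tmap_r; ra.
  rewrite (comp_sq (esym (assoc_bwd_nat3 _ _ _))) (comp_assoc (bwd (assoc (M ⊗ _) _ _))).
  rewrite (comp_pre (pentagon_bwd_l _ _ _ _)).
  rewrite -!comp_assoc (comp_sq (esym (assoc_bwd_nat2 _ _ _))).
  by rewrite (comp_pre (triangle_bwd _ _)).
Qed.

(** The composite contains the zigzag of [D'] on [M], tensored with [dual D] and followed
    by [ev D]. *)
Lemma mate_ev : ev D' ∘ (mate ⊗₁ 1) = ev D.
Proof.
  (* The two evaluations are performed in either order. *)
  have R : ev D' ∘ ((lunit (dual D') ⊗₁ 1) ∘ ((ev D ⊗₁ 1) ⊗₁ 1))
           = ev D ∘ (runit (dual D ⊗ M) ∘ ((1 ⊗₁ ev D') ∘ assoc (dual D ⊗ M) (dual D') M)).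
  { rewrite -assoc_lunit; ra. rewrite assoc_nat1.
    rewrite !comp_assoc; congr (_ ∘ _).
    rewrite -lunit_nat -runit_nat -lunit_runit_munit; ra.
    by rewrite tmap_swap. }
  rewrite -[RHS]comp_idr -tmap_id -{2}(dual_triangle_l D') /mate !tmap_l !tmap_r; ra.
  cbn [fwd inv].
  rewrite (comp_assoc (lunit _ ⊗₁ 1)) (comp_assoc (ev D')) R; ra; congr (_ ∘ _).
  rewrite -assoc_runit; ra; congr (_ ∘ _).
  rewrite triangle_bwd_r (comp_sq (esym (assoc_bwd_nat2 _ _ _))).
  rewrite (comp_sq (assoc_nat3 _ _ _)); congr (_ ∘ _).
  rewrite (comp_pre (pentagon _ _ _ _)); ra.
  rewrite (comp_assoc (assoc _ _ _ ⊗₁ 1)) -tmap_l fwd_bwd tmap_id comp_idl.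
  by rewrite fwd_bwd_comp.
Qed.

End Mate.

(** Write the loop of [D] with [ev D = ev D' ∘ (mate ⊗ 1)] and slide the mate around the
    loop to the coevaluation, where it turns [coev D] into [coev D']. *)
Lemma sm_endo_trace_unique {M : V} (D D' : Dual M) (f : M ⟶ M) :
  sm_endo_trace D f = sm_endo_trace D' f.
Proof.
  rewrite !sm_endo_trace_loop -(mate_ev D D') -(mate_coev D D').
  ra. rewrite (comp_sq (esym (braid_nat _ _))).
  by rewrite (comp_sq (esym (tmap_swap _ _))).
Qed.

End SymmetricMonoidalTraces.

(** * Opcartesian morphisms *)

Section Pushforward.
Context {S : Category} {P : FiniteProducts S} {C : IndexedSMC S} (H : HoCoproducts P C).
Local Notation "f ^*" := (reidx C f) (at level 2, left associativity, format "f ^*").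
Local Notation "Σ[ f ]" := (push H f) (at level 0, format "Σ[ f ]").

(** Composition with the opcartesian morphism [Y → Σ[g] Y]. *)
Definition push_elt {T A B : S} {f : T ⟶ A} {g : A ⟶ B} {h : T ⟶ B} (e : g ∘ f = h)
    {X : fib C T} {Y : fib C A} (x : X ⟶ f^* Y) : X ⟶ h^* (Σ[g] Y) :=
  over_comp e (adj_unit Σ[g] Y) x.

Lemma push_elt_pre {T A B : S} {f : T ⟶ A} {g : A ⟶ B} {h : T ⟶ B} (e : g ∘ f = h)
    {X X' : fib C T} {Y : fib C A} (x : X ⟶ f^* Y) (w : X' ⟶ X) :
  push_elt e x ∘ w = push_elt e (x ∘ w).
Proof. exact: over_comp_pre. Qed.

Lemma push_elt_map {T A B : S} {f : T ⟶ A} {g : A ⟶ B} {h : T ⟶ B} (e : g ∘ f = h)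
    {X : fib C T} {Y Z : fib C A} (x : X ⟶ f^* Y) (w : Y ⟶ Z) :
  fmap (h^*) (fmap Σ[g] w) ∘ push_elt e x = push_elt e (fmap (f^*) w ∘ x).
Proof. by rewrite /push_elt over_comp_post -adj_unit_nat over_comp_mid. Qed.

(** [push_comp] comes from uniqueness of left adjoints, so it is determined by being
    compatible with the units, that is, with opcartesian morphisms. *)
Lemma push_tri_unit {A B D : S} {f : A ⟶ B} {g : B ⟶ D} {h : A ⟶ D} (e : g ∘ f = h)
    (M : fib C A) :
  fmap (h^*) (push_tri H e M) ∘ over_comp e (adj_unit Σ[g] _) (adj_unit Σ[f] M)
  = adj_unit Σ[h] M.
Proof.
  destruct e.
  rewrite /push_tri /push_eq /= comp_idl.
  rewrite /over_comp comp_assoc -reidx_tri_nat -comp_assoc.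
  apply: (fwd_inj (i := inv (reidx_tri eq_refl _))).
  cbn [fwd inv]; rewrite bwd_fwd_comp.
  have E := transpose_unit (adj_comp Σ[f] Σ[g])
    (bwd (reidx_comp C f g (Σ[g ∘ f] M)) ∘ adj_unit Σ[g ∘ f] M).
  rewrite /= in E; rewrite E; congr (_ ∘ _).
  by rewrite bwd_tri_refl.
Qed.

Lemma push_elt_push_tri {T A B D : S} {s : T ⟶ A} {f : A ⟶ B} {g : B ⟶ D} {h : A ⟶ D}
    {p : T ⟶ B} {t : T ⟶ D} (e : g ∘ f = h) (e1 : f ∘ s = p) (e2 : g ∘ p = t)
    (e3 : h ∘ s = t) {X : fib C T} {M : fib C A} (x : X ⟶ s^* M) :
  fmap (t^*) (push_tri H e M) ∘ push_elt e2 (push_elt e1 x) = push_elt e3 x.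
Proof.
  by rewrite /push_elt (over_comp_assoc e1 e2 e e3) over_comp_post push_tri_unit.
Qed.

Lemma push_elt_push_id {T A : S} {s : T ⟶ A} (e : idm A ∘ s = s)
    {X : fib C T} {M : fib C A} (x : X ⟶ s^* M) :
  fmap (s^*) (push_id H M) ∘ push_elt e x = x.
Proof.
  rewrite /push_elt over_comp_post.
  have -> : fmap ((idm A)^*) (push_id H M) ∘ adj_unit Σ[idm A] M
            = reidx_id C A M ∘ idm M.
  { exact: transpose_unit. }
  by rewrite over_comp_idl fmap_id comp_idl.
Qed.

(** The Beck-Chevalley morphism is the transpose of [h^*] applied to the unit of [k]; in
    the total category, it is the unique comparison between [M ← h^* M → Σ[f] h^* M] and
    [M → Σ[k] M ← g^* Σ[k] M]. *)
Lemma bc_unit {A B D E : S} {f : A ⟶ B} {h : A ⟶ D} {g : B ⟶ E} {k : D ⟶ E}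
    (e : g ∘ f = k ∘ h) (b : BasicSquare P f h g k) (M : fib C D) :
  fmap (f^*) (beck_chevalley H e b M) ∘ adj_unit Σ[f] (h^* M)
  = lift e (over_comp eq_refl (adj_unit Σ[k] M) (idm (h^* M))).
Proof.
  rewrite /=/bc_map. rewrite -[in LHS]comp_assoc -(fmap_comp Σ[f]).
  rewrite (transpose_unit Σ[f]).
  by rewrite /over_comp comp_idr -reidx_sq_tri.
Qed.

(** A morphism that factors through [M → Σ[k] M], pulled back along [g], factors through
    [h^* M → Σ[f] h^* M] by way of the inverse Beck-Chevalley morphism. *)
Lemma push_elt_bc {T A B D E : S} {f : A ⟶ B} {h : A ⟶ D} {g : B ⟶ E} {k : D ⟶ E}
    (e : g ∘ f = k ∘ h) (b : BasicSquare P f h g k) {M : fib C D}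
    {s : T ⟶ A} {t : T ⟶ B} {p : T ⟶ D} {q : T ⟶ E}
    (e1 : f ∘ s = t) (e2 : g ∘ t = q) (e3 : k ∘ p = q) (e4 : h ∘ s = p)
    {X : fib C T} (x : X ⟶ p^* M) :
  fmap (t^*) (bwd (beck_chevalley H e b M)) ∘ lift e2 (push_elt e3 x)
  = push_elt e1 (lift e4 x).
Proof.
  apply: fmap_bwd_eq.
  rewrite /push_elt over_comp_post bc_unit.
  have e5 : (k ∘ h) ∘ s = q by rewrite -comp_assoc e4.
  rewrite (over_comp_lift e1 e2 e e5); congr (lift _ _).
  rewrite -(over_comp_assoc e4 e3 eq_refl e5); congr (over_comp _ _ _).
  by rewrite /over_comp fmap_id comp_idl tri_lift.
Qed.

Lemma push_elt_proj {T A B : S} {f : A ⟶ B} {M : fib C B} {N : fib C A}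
    {s : T ⟶ A} {t : T ⟶ B} (e : f ∘ s = t) {X Y : fib C T}
    (y : Y ⟶ t^* M) (x : X ⟶ s^* N) :
  fmap (t^*) (bwd (projection H f M N)) ∘ over_tens y (push_elt e x)
  = push_elt e (over_tens (lift e y) x).
Proof.
  apply: fmap_bwd_eq.
  rewrite /push_elt over_comp_post.
  have -> : fmap (f^*) (projection H f M N) ∘ adj_unit Σ[f] (f^* M ⊗ N)
            = over_tens (idm _) (adj_unit Σ[f] N).
  { rewrite /=/proj_map. rewrite -[in LHS]comp_assoc -(fmap_comp Σ[f]).
    exact: transpose_unit. }
  rewrite over_comp_tens; congr (over_tens _ _).
  by rewrite /over_comp fmap_id comp_idl tri_lift.
Qed.

Lemma push_elt_idr {A B : S} {f : A ⟶ B} (e : f ∘ idm A = f) {X Y : fib C A} (u : X ⟶ Y) :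
  push_elt e (reidx_id C A Y ∘ u) = adj_unit Σ[f] Y ∘ u.
Proof. exact: over_comp_idr. Qed.

Lemma push_elt_push_eq {T A B : S} {s : T ⟶ A} {f g : A ⟶ B} {t : T ⟶ B} (e : f = g)
    (e1 : f ∘ s = t) (e2 : g ∘ s = t) {X : fib C T} {M : fib C A} (x : X ⟶ s^* M) :
  fmap (t^*) (push_eq H e M) ∘ push_elt e1 x = push_elt e2 x.
Proof.
  destruct e; rewrite (proof_irrelevance _ e2 e1) /push_eq /= fmap_id comp_idl.
  reflexivity.
Qed.

Lemma isiso_push_unit {A B : S} {f : A ⟶ B} {g : B ⟶ A} (e : g ∘ f = idm A)
    (e' : f ∘ g = idm B) (X : fib C A) : IsIso (adj_unit Σ[f] X).
Proof.
  exact: (adj_unit_isiso Σ[f] (K := g^*)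
    (fun y y' u => reidx_inverse_nat e' u) (fun x x' u => reidx_inverse_nat e u)).
Qed.

End Pushforward.

(** * Elements of external products *)

Section ExternalProduct.
Context {S : Category} {P : FiniteProducts S} {C : IndexedSMC S} (H : HoCoproducts P C).
Local Notation "A × B" := (prod P A B).
Local Notation "⟨ f , g ⟩" := (pair P f g).
Local Notation "f ×₁ g" := (prod_map P f g) (at level 36, left associativity).
Local Notation "⋆" := (star P).
Local Notation π₁ := (fst P _ _).
Local Notation π₂ := (snd P _ _).
Local Notation "f ^*" := (reidx C f) (at level 2, left associativity, format "f ^*").
Local Notation "Σ[ f ]" := (push H f) (at level 0, format "Σ[ f ]").
Local Notation "M ⊠ N" := (box (P := P) M N) (at level 37, right associativity).

(** The external product of elements.  The base point [t] of [A × B] is given by its two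
    coordinates, which need not be literally the components of a pairing. *)
Definition box_elt {T A B : S} {t : T ⟶ A × B} {m : T ⟶ A} {n : T ⟶ B}
    (e1 : π₁ ∘ t = m) (e2 : π₂ ∘ t = n) {X Y : fib C T} {M : fib C A} {N : fib C B}
    (p : X ⟶ m^* M) (q : Y ⟶ n^* N) : X ⊗ Y ⟶ t^* (M ⊠ N) :=
  over_tens (lift e1 p) (lift e2 q).

Lemma pair_box_elt {T A B : S} {m : T ⟶ A} {n : T ⟶ B}
    {X Y : fib C T} {M : fib C A} {N : fib C B}
    (p : X ⟶ m^* M) (q : Y ⟶ n^* N) :
  bwd (pair_box m n M N) ∘ (p ⊗₁ q) = box_elt (fst_pair P m n) (snd_pair P m n) p q.
Proof.
  rewrite /pair_box /box_elt /over_tens /lift. cbn [fwd bwd inv iso_comp tens_iso].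
  by rewrite -comp_assoc -tmap_comp.
Qed.

Lemma pair_box_bwd {T A B : S} {m : T ⟶ A} {n : T ⟶ B} (M : fib C A) (N : fib C B) :
  bwd (pair_box m n M N) = box_elt (fst_pair P m n) (snd_pair P m n) (idm _) (idm _).
Proof. by rewrite -pair_box_elt tmap_id comp_idr. Qed.

Lemma box_elt_pre {T A B : S} {t : T ⟶ A × B} {m : T ⟶ A} {n : T ⟶ B}
    (e1 : π₁ ∘ t = m) (e2 : π₂ ∘ t = n) {X Y X' Y' : fib C T} {M : fib C A} {N : fib C B}
    (p : X ⟶ m^* M) (q : Y ⟶ n^* N) (i : X' ⟶ X) (j : Y' ⟶ Y) :
  box_elt e1 e2 p q ∘ (i ⊗₁ j) = box_elt e1 e2 (p ∘ i) (q ∘ j).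
Proof. by rewrite /box_elt over_tens_pre !lift_pre. Qed.

Lemma box_elt_map {T A B : S} {t : T ⟶ A × B} {m : T ⟶ A} {n : T ⟶ B}
    (e1 : π₁ ∘ t = m) (e2 : π₂ ∘ t = n) {X Y : fib C T} {M M' : fib C A} {N N' : fib C B}
    (p : X ⟶ m^* M) (q : Y ⟶ n^* N) (i : M ⟶ M') (j : N ⟶ N') :
  fmap (t^*) (box_map i j) ∘ box_elt e1 e2 p q
  = box_elt e1 e2 (fmap (m^*) i ∘ p) (fmap (n^*) j ∘ q).
Proof. by rewrite /box_elt /box_map over_tens_post !lift_post. Qed.

Lemma box_elt_comp {T' T A B : S} {s : T' ⟶ T} {t : T ⟶ A × B} {t' : T' ⟶ A × B}
    {m : T ⟶ A} {n : T ⟶ B} {m' : T' ⟶ A} {n' : T' ⟶ B}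
    (e : t ∘ s = t') (e1 : π₁ ∘ t = m) (e2 : π₂ ∘ t = n)
    (e1' : π₁ ∘ t' = m') (e2' : π₂ ∘ t' = n') (e3 : m ∘ s = m') (e4 : n ∘ s = n')
    {X Y : fib C T'} {X' Y' : fib C T} {M : fib C A} {N : fib C B}
    (p : X' ⟶ m^* M) (q : Y' ⟶ n^* N) (x : X ⟶ s^* X') (y : Y ⟶ s^* Y') :
  over_comp e (box_elt e1 e2 p q) (over_tens x y)
  = box_elt e1' e2' (over_comp e3 p x) (over_comp e4 q y).
Proof.
  by rewrite /box_elt over_comp_tens (over_comp_lift e e1' e1 e3) (over_comp_lift e e2' e2 e4).
Qed.

(** [pair_box] itself is an external product of elements, so its effect follows from
    compatibility of external products with composition; all canonical isomorphisms for
    external products below are built from it. *)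
Lemma box_elt_pair_box {T A B D : S} {m : D ⟶ A} {n : D ⟶ B} {s : T ⟶ D}
    {t : T ⟶ A × B} {m' : T ⟶ A} {n' : T ⟶ B}
    (e : ⟨m, n⟩ ∘ s = t) (e1 : m ∘ s = m') (e2 : n ∘ s = n')
    (e1' : π₁ ∘ t = m') (e2' : π₂ ∘ t = n')
    {X Y : fib C T} {M : fib C A} {N : fib C B} (p : X ⟶ m'^* M) (q : Y ⟶ n'^* N) :
  fmap (s^*) (bwd (pair_box m n M N)) ∘ over_tens (lift e1 p) (lift e2 q)
  = lift e (box_elt e1' e2' p q).
Proof.
  rewrite pair_box_bwd (over_comp_def e) (box_elt_comp e _ _ e1' e2' e1 e2).
  by rewrite !over_comp_idm !tri_lift.
Qed.

Lemma box_elt_reidx {T A A' B B' : S} {f : A ⟶ A'} {g : B ⟶ B'}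
    {s : T ⟶ A × B} {t : T ⟶ A' × B'} {m : T ⟶ A} {n : T ⟶ B} {m' : T ⟶ A'} {n' : T ⟶ B'}
    (e : (f ×₁ g) ∘ s = t) (e1 : π₁ ∘ s = m) (e2 : π₂ ∘ s = n)
    (e1' : π₁ ∘ t = m') (e2' : π₂ ∘ t = n') (e3 : f ∘ m = m') (e4 : g ∘ n = n')
    {X Y : fib C T} {M : fib C A'} {N : fib C B'}
    (p : X ⟶ m^* (f^* M)) (q : Y ⟶ n^* (g^* N)) :
  fmap (s^*) (box_reidx f g M N) ∘ box_elt e1 e2 p q
  = lift e (box_elt e1' e2' (reidx_tri e3 M ∘ p) (reidx_tri e4 N ∘ q)).
Proof.
  have E1 : (f ∘ fst P A B) ∘ s = m' by rewrite -comp_assoc e1.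
  have E2 : (g ∘ snd P A B) ∘ s = n' by rewrite -comp_assoc e2.
  rewrite -(box_elt_pair_box e E1 E2 e1' e2').
  rewrite /box_reidx. cbn [fwd iso_comp inv bwd]. rewrite fmap_comp -comp_assoc; congr (_ ∘ _).
  rewrite over_tens_post; congr (over_tens _ _).
  - rewrite -(lift_lift e1 e3 erefl E1) lift_tri. by rewrite tri_refl.
  - rewrite -(lift_lift e2 e4 erefl E2) lift_tri. by rewrite tri_refl.
Qed.

Lemma reidx_tri_id_l {T B : S} {n : T ⟶ B} (e : idm B ∘ n = n) {Y : fib C T} {N : fib C B}
    (q : Y ⟶ n^* N) : reidx_tri e N ∘ (fmap (n^*) (reidx_id C B N) ∘ q) = q.
Proof.
  move: (over_comp_idl e (idm N) q); by rewrite /over_comp comp_idr fmap_id comp_idl.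
Qed.

Lemma lift_id {T B : S} {n : T ⟶ B} (e : idm B ∘ n = n) {Y : fib C T} {N : fib C B}
    (q : Y ⟶ n^* N) : fmap (n^*) (bwd (reidx_id C B N)) ∘ lift e q = q.
Proof.
  by apply: fmap_bwd_eq; apply: (fwd_inj (i := reidx_tri e N)); rewrite reidx_tri_id_l tri_lift.
Qed.

Lemma box_elt_reidx_l {T A A' B : S} {f : A ⟶ A'}
    {s : T ⟶ A × B} {t : T ⟶ A' × B} {m : T ⟶ A} {n : T ⟶ B} {m' : T ⟶ A'}
    (e : (f ×₁ idm B) ∘ s = t) (e1 : π₁ ∘ s = m) (e2 : π₂ ∘ s = n)
    (e1' : π₁ ∘ t = m') (e2' : π₂ ∘ t = n) (e3 : f ∘ m = m')
    {X Y : fib C T} {M : fib C A'} {N : fib C B} (p : X ⟶ m^* (f^* M)) (q : Y ⟶ n^* N) :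
  fmap (s^*) (box_reidx_l f M N) ∘ box_elt e1 e2 p q
  = lift e (box_elt e1' e2' (reidx_tri e3 M ∘ p) q).
Proof.
  have -> : fwd (box_reidx_l f M N)
            = box_reidx f (idm B) M N ∘ box_map (idm (f^* M)) (reidx_id C B N) by [].
  rewrite fmap_comp -comp_assoc.
  rewrite (box_elt_map e1 e2 p q (idm _) (reidx_id C B N)) fmap_id comp_idl.
  have E : idm B ∘ n = n by apply: comp_idl.
  by rewrite (box_elt_reidx e e1 e2 e1' e2' e3 E) reidx_tri_id_l.
Qed.

Lemma box_elt_reidx_r {T A B B' : S} {g : B ⟶ B'}
    {s : T ⟶ A × B} {t : T ⟶ A × B'} {m : T ⟶ A} {n : T ⟶ B} {n' : T ⟶ B'}
    (e : (idm A ×₁ g) ∘ s = t) (e1 : π₁ ∘ s = m) (e2 : π₂ ∘ s = n)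
    (e1' : π₁ ∘ t = m) (e2' : π₂ ∘ t = n') (e4 : g ∘ n = n')
    {X Y : fib C T} {M : fib C A} {N : fib C B'} (p : X ⟶ m^* M) (q : Y ⟶ n^* (g^* N)) :
  fmap (s^*) (box_reidx_r g M N) ∘ box_elt e1 e2 p q
  = lift e (box_elt e1' e2' p (reidx_tri e4 N ∘ q)).
Proof.
  have -> : fwd (box_reidx_r g M N)
            = box_reidx (idm A) g M N ∘ box_map (reidx_id C A M) (idm (g^* N)) by [].
  rewrite fmap_comp -comp_assoc.
  rewrite (box_elt_map e1 e2 p q (reidx_id C A M) (idm _)) fmap_id comp_idl.
  have E : idm A ∘ m = m by apply: comp_idl.
  by rewrite (box_elt_reidx e e1 e2 e1' e2' E e4) reidx_tri_id_l.
Qed.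

Lemma box_elt_assoc {T A B D : S} {s : T ⟶ (A × B) × D} {t : T ⟶ A × (B × D)}
    {m : T ⟶ A} {n : T ⟶ B} {l : T ⟶ D} {mn : T ⟶ A × B} {nl : T ⟶ B × D}
    (e : prod_assoc P A B D ∘ s = t)
    (e1 : π₁ ∘ mn = m) (e2 : π₂ ∘ mn = n) (e3 : π₁ ∘ s = mn) (e4 : π₂ ∘ s = l)
    (e1' : π₁ ∘ nl = n) (e2' : π₂ ∘ nl = l) (e3' : π₁ ∘ t = m) (e4' : π₂ ∘ t = nl)
    {X Y Z : fib C T} {M : fib C A} {N : fib C B} {L : fib C D}
    (p : X ⟶ m^* M) (q : Y ⟶ n^* N) (r : Z ⟶ l^* L) :
  fmap (s^*) (box_assoc (P := P) M N L) ∘ box_elt e3 e4 (box_elt e1 e2 p q) r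
  = lift e (box_elt e3' e4' p (box_elt e1' e2' q r)) ∘ assoc X Y Z.
Proof.
  have E1 : (fst P A B ∘ fst P (A × B) D) ∘ s = m by rewrite -comp_assoc e3.
  have E2 : (snd P A B ∘ fst P (A × B) D) ∘ s = n by rewrite -comp_assoc e3.
  have E : ⟨snd P A B ∘ fst P (A × B) D, snd P (A × B) D⟩ ∘ s = nl.
  { apply: pair_ext; by rewrite comp_assoc ?fst_pair ?snd_pair ?e1' ?e2'. }
  have E' : ⟨fst P A B ∘ fst P (A × B) D, ⟨snd P A B ∘ fst P (A × B) D, snd P (A × B) D⟩⟩ ∘ s = t.
  { exact: e. }
  rewrite (lift_eq e E') -(box_elt_pair_box E' E1 E e3' e4').
  rewrite /box_assoc. cbn [fwd iso_comp inv bwd tens_iso iso_id].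
  rewrite -> !fmap_comp; ra; congr (_ ∘ _).
  rewrite {1}/box_elt over_tens_post fmap_comp -comp_assoc.
  have -> : fmap (s^*) (bwd (smf_mu ((fst P (A × B) D)^*) _ _)) ∘ lift e3 (box_elt e1 e2 p q)
            = over_tens (lift e3 (lift e1 p)) (lift e3 (lift e2 q)).
  { by apply: fmap_bwd_eq; rewrite mu_lift. }
  rewrite over_tens_post -!tri_refl (lift_lift e3 e1 erefl E1) (lift_lift e3 e2 erefl E2).
  rewrite fmap_id comp_idl over_tens_assoc; la.
  congr (_ ∘ _). rewrite over_tens_post fmap_id comp_idl.
  by rewrite (box_elt_pair_box E E2 e4 e1' e2').
Qed.

Lemma box_elt_swap {T A B : S} {s : T ⟶ A × B} {t : T ⟶ B × A} {m : T ⟶ A} {n : T ⟶ B}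
    (e : swap (P := P) A B ∘ s = t) (e1 : π₁ ∘ s = m) (e2 : π₂ ∘ s = n)
    (e1' : π₁ ∘ t = n) (e2' : π₂ ∘ t = m)
    {X Y : fib C T} {M : fib C A} {N : fib C B} (p : X ⟶ m^* M) (q : Y ⟶ n^* N) :
  fmap (s^*) (box_swap (P := P) M N) ∘ box_elt e1 e2 p q
  = lift e (box_elt e1' e2' q p) ∘ braid X Y.
Proof.
  rewrite -(box_elt_pair_box e e2 e1 e1' e2') /box_swap.
  cbn [fwd iso_comp inv bwd braid_iso].
  rewrite -> fmap_comp; ra; congr (_ ∘ _). by rewrite over_tens_braid.
Qed.

Lemma lift_eps {T A B : S} {f : T ⟶ A} {g : A ⟶ B} {h : T ⟶ B} (e : g ∘ f = h) :
  fmap (f^*) (bwd (smf_eps (g^*))) ∘ lift e (smf_eps (h^*)) = smf_eps (f^*).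
Proof. by apply: fmap_bwd_eq; rewrite -(reidx_tri_eps e) lift_tri. Qed.

Lemma box_elt_unit_r {T A : S} {s : T ⟶ A × ⋆} {m : T ⟶ A} {n : T ⟶ ⋆}
    (e1 : π₁ ∘ s = m) (e2 : π₂ ∘ s = n) {X : fib C T} {M : fib C A} (p : X ⟶ m^* M) :
  fmap (s^*) (box_unit_r (P := P) M) ∘ box_elt e1 e2 p (smf_eps (n^*))
  = lift e1 p ∘ runit X.
Proof.
  rewrite /box_unit_r. cbn [fwd iso_comp inv bwd tens_iso iso_id].
  rewrite fmap_comp -comp_assoc /box_elt over_tens_post lift_eps fmap_id comp_idl.
  by rewrite over_tens_runit.
Qed.

Lemma box_elt_unit_l {T A : S} {s : T ⟶ ⋆ × A} {m : T ⟶ A} {n : T ⟶ ⋆}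
    (e1 : π₁ ∘ s = n) (e2 : π₂ ∘ s = m) {X : fib C T} {M : fib C A} (p : X ⟶ m^* M) :
  fmap (s^*) (box_unit_l (P := P) M) ∘ box_elt e1 e2 (smf_eps (n^*)) p
  = lift e2 p ∘ lunit X.
Proof.
  rewrite /box_unit_l. cbn [fwd iso_comp inv bwd tens_iso iso_id].
  rewrite fmap_comp -comp_assoc /box_elt over_tens_post lift_eps fmap_id comp_idl.
  by rewrite over_tens_lunit.
Qed.

(** The chain of isomorphisms defining [box_push_l] is followed one by one: Beck-Chevalley
    moves the pushforward of the first factor out of the reindexing, the projection formula
    out of the tensor product; the two braidings cancel. *)
Lemma box_elt_push_l {T A A' B : S} {f : A ⟶ A'}
    {s : T ⟶ A × B} {t : T ⟶ A' × B} {m : T ⟶ A} {n : T ⟶ B} {m' : T ⟶ A'}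
    (e : (f ×₁ idm B) ∘ s = t) (e1 : π₁ ∘ s = m) (e2 : π₂ ∘ s = n)
    (e1' : π₁ ∘ t = m') (e2' : π₂ ∘ t = n) (e3 : f ∘ m = m')
    {X Y : fib C T} {M : fib C A} {N : fib C B} (p : X ⟶ m^* M) (q : Y ⟶ n^* N) :
  fmap (t^*) (box_push_l H f M N) ∘ box_elt e1' e2' (push_elt H e3 p) q
  = push_elt H e (box_elt e1 e2 p q).
Proof.
  rewrite /box_push_l. cbn [fwd iso_comp inv bwd tens_iso iso_id braid_iso].
  rewrite -> !(fmap_comp (t^*)); ra.
  rewrite {1}/box_elt over_tens_post fmap_id comp_idl.
  rewrite (push_elt_bc _ _ _ e e1' e3 e1) over_tens_braid.
  rewrite (comp_pre (push_elt_proj _ _ _ _)) push_elt_pre push_elt_map; congr (push_elt _ _ _).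
  rewrite fmap_comp -comp_assoc (comp_sq (over_tens_braid _ _)) braid_braid comp_idr.
  cbn [fwd tens_iso iso_id].
  rewrite over_tens_post fmap_id comp_idl; congr (over_tens _ _).
  exact: lift_lift.
Qed.

Lemma box_elt_push_r {T A B B' : S} {g : B ⟶ B'}
    {s : T ⟶ A × B} {t : T ⟶ A × B'} {m : T ⟶ A} {n : T ⟶ B} {n' : T ⟶ B'}
    (e : (idm A ×₁ g) ∘ s = t) (e1 : π₁ ∘ s = m) (e2 : π₂ ∘ s = n)
    (e1' : π₁ ∘ t = m) (e2' : π₂ ∘ t = n') (e4 : g ∘ n = n')
    {X Y : fib C T} {M : fib C A} {N : fib C B} (p : X ⟶ m^* M) (q : Y ⟶ n^* N) :
  fmap (t^*) (box_push_r H g M N) ∘ box_elt e1' e2' p (push_elt H e4 q)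
  = push_elt H e (box_elt e1 e2 p q).
Proof.
  rewrite /box_push_r. cbn [fwd iso_comp inv bwd tens_iso iso_id braid_iso].
  rewrite -> !(fmap_comp (t^*)); ra.
  rewrite {1}/box_elt over_tens_post fmap_id comp_idl.
  rewrite (push_elt_bc _ _ _ e e2' e4 e2).
  rewrite push_elt_proj push_elt_map; congr (push_elt _ _ _).
  rewrite over_tens_post fmap_id comp_idl; congr (over_tens _ _).
  exact: lift_lift.
Qed.

Lemma isiso_box_elt {T A B : S} {t : T ⟶ A × B} {m : T ⟶ A} {n : T ⟶ B}
    (e1 : π₁ ∘ t = m) (e2 : π₂ ∘ t = n) {X Y : fib C T} {M : fib C A} {N : fib C B}
    (p : X ⟶ m^* M) (q : Y ⟶ n^* N) : IsIso p -> IsIso q -> IsIso (box_elt e1 e2 p q).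
Proof.
  move=> i j; apply: isiso_comp; first exact: isiso_fwd.
  by apply: isiso_tmap; apply: isiso_lift.
Qed.

End ExternalProduct.

(** * Elements of composites, units and shadows *)

Ltac base_eq :=
  unfold mid3, dup3, dup, mid, dup_shift, dup_r, dup_l, cyc, cyc', swap; prod_eq.

Section Bicategory.
Context {S : Category} {P : FiniteProducts S} {C : IndexedSMC S} (H : HoCoproducts P C).
Local Notation "A × B" := (prod P A B).
Local Notation "⟨ f , g ⟩" := (pair P f g).
Local Notation "f ×₁ g" := (prod_map P f g) (at level 36, left associativity).
Local Notation "⋆" := (star P).
Local Notation π := (bang P).
Local Notation Δ := (diag P).
Local Notation π₁ := (fst P _ _).
Local Notation π₂ := (snd P _ _).
Local Notation "f ^*" := (reidx C f) (at level 2, left associativity, format "f ^*").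
Local Notation "Σ[ f ]" := (push H f) (at level 0, format "Σ[ f ]").
Local Notation "M ⊠ N" := (box (P := P) M N) (at level 37, right associativity).
Local Notation "M ⊙ N" := (hcomp H M N) (at level 39, right associativity).
Local Notation "u ⊙₁ v" := (hcomp_map H u v) (at level 39, right associativity).
Local Notation box_elt2 := (box_elt (fst_pair P _ _) (snd_pair P _ _)).

Lemma mid_base {T A B D : S} (a : T ⟶ A) (b : T ⟶ B) (d : T ⟶ D) :
  mid A B D ∘ ⟨⟨a, b⟩, d⟩ = ⟨a, d⟩.
Proof. base_eq. Qed.

Lemma dup_base {T A B D : S} (a : T ⟶ A) (b : T ⟶ B) (d : T ⟶ D) :
  dup A B D ∘ ⟨⟨a, b⟩, d⟩ = ⟨⟨a, b⟩, ⟨b, d⟩⟩.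
Proof. base_eq. Qed.

(** The canonical map [M(a, b) ⊗ N(b, d) → (M ⊙ N)(a, d)] into the coproduct over the
    middle variable, evaluated on elements. *)
Definition hcomp_elt {T A B D : S} {a : T ⟶ A} {b : T ⟶ B} {d : T ⟶ D} {X Y : fib C T}
    {M : fib C (A × B)} {N : fib C (B × D)} (p : X ⟶ ⟨a, b⟩^* M) (q : Y ⟶ ⟨b, d⟩^* N) :
    X ⊗ Y ⟶ ⟨a, d⟩^* (M ⊙ N) :=
  push_elt H (mid_base a b d) (lift (dup_base a b d) (box_elt2 p q)).

Lemma hcomp_elt_pre {T A B D : S} {a : T ⟶ A} {b : T ⟶ B} {d : T ⟶ D} {X Y X' Y' : fib C T}
    {M : fib C (A × B)} {N : fib C (B × D)} (p : X ⟶ ⟨a, b⟩^* M) (q : Y ⟶ ⟨b, d⟩^* N)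
    (i : X' ⟶ X) (j : Y' ⟶ Y) :
  hcomp_elt p q ∘ (i ⊗₁ j) = hcomp_elt (p ∘ i) (q ∘ j).
Proof. by rewrite /hcomp_elt push_elt_pre lift_pre box_elt_pre. Qed.

Lemma hcomp_elt_map {T A B D : S} {a : T ⟶ A} {b : T ⟶ B} {d : T ⟶ D} {X Y : fib C T}
    {M M' : fib C (A × B)} {N N' : fib C (B × D)}
    (p : X ⟶ ⟨a, b⟩^* M) (q : Y ⟶ ⟨b, d⟩^* N) (u : M ⟶ M') (v : N ⟶ N') :
  fmap (⟨a, d⟩^*) (u ⊙₁ v) ∘ hcomp_elt p q
  = hcomp_elt (fmap (⟨a, b⟩^*) u ∘ p) (fmap (⟨b, d⟩^*) v ∘ q).
Proof. by rewrite /hcomp_elt /hcomp_map push_elt_map lift_post box_elt_map. Qed.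

Section Associator.
Context {T A B D E : S} {a : T ⟶ A} {b : T ⟶ B} {d : T ⟶ D} {e : T ⟶ E}
  {X Y Z : fib C T} {M : fib C (A × B)} {N : fib C (B × D)} {L : fib C (D × E)}
  (p : X ⟶ ⟨a, b⟩^* M) (q : Y ⟶ ⟨b, d⟩^* N) (r : Z ⟶ ⟨d, e⟩^* L).

Lemma mid3_base : mid3 A B D E ∘ ⟨⟨⟨a, b⟩, d⟩, e⟩ = ⟨a, e⟩.
Proof. base_eq. Qed.

Lemma dup3_base : dup3 A B D E ∘ ⟨⟨⟨a, b⟩, d⟩, e⟩ = ⟨⟨⟨a, b⟩, ⟨b, d⟩⟩, ⟨d, e⟩⟩.
Proof. base_eq. Qed.

(** The product of three elements in the unbracketed triple composite. *)
Definition hcomp_elt3 : (X ⊗ Y) ⊗ Z ⟶ ⟨a, e⟩^* (hcomp3 H M N L) :=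
  push_elt H mid3_base (lift dup3_base (box_elt2 (box_elt2 p q) r)).

(** Each factor of [hcomp3_l] moves one pushforward or reindexing past a product of
    elements: first the inner pushforward leaves the external product, then Beck-Chevalley
    takes it past [dup], the two pushforwards are composed, and the remaining reindexings
    are composed. *)
Lemma hcomp_elt_hcomp3_l :
  fmap (⟨a, e⟩^*) (hcomp3_l H M N L) ∘ hcomp_elt (hcomp_elt p q) r = hcomp_elt3.
Proof.
  have e1 : (mid A B D ×₁ idm (D × E)) ∘ ⟨⟨⟨a, b⟩, d⟩, ⟨d, e⟩⟩ = ⟨⟨a, d⟩, ⟨d, e⟩⟩ by base_eq.
  have e2 : (mid A B D ×₁ idm E) ∘ ⟨⟨⟨a, b⟩, d⟩, e⟩ = ⟨⟨a, d⟩, e⟩ by base_eq.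
  have e3 : dup (P := P) (A × B) D E ∘ ⟨⟨⟨a, b⟩, d⟩, e⟩ = ⟨⟨⟨a, b⟩, d⟩, ⟨d, e⟩⟩ by base_eq.
  have e4 : (dup A B D ×₁ idm (D × E)) ∘ ⟨⟨⟨a, b⟩, d⟩, ⟨d, e⟩⟩
            = ⟨⟨⟨a, b⟩, ⟨b, d⟩⟩, ⟨d, e⟩⟩ by base_eq.
  rewrite /hcomp3_l /hcomp_elt3 {1}/hcomp_elt.
  cbn [fwd iso_comp inv bwd fmap_iso].
  rewrite -> !fmap_comp; ra.
  rewrite !push_elt_map lift_post.
  rewrite (box_elt_push_l H e1 (fst_pair P _ _) (snd_pair P _ _)).
  rewrite (push_elt_bc _ _ _ e2 _ _ e3).
  rewrite (push_elt_push_tri _ _ _ _ mid3_base).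
  rewrite !push_elt_map lift_post.
  rewrite (box_elt_reidx_l e4 _ _ (fst_pair P _ _) (snd_pair P _ _) (dup_base a b d)).
  by rewrite (lift_lift e3 e4 (assoc_dup_l A B D E) dup3_base) tri_lift.
Qed.

Lemma hcomp_elt_hcomp3_r :
  fmap (⟨a, e⟩^*) (hcomp3_r H M N L) ∘ hcomp_elt p (hcomp_elt q r) ∘ assoc X Y Z = hcomp_elt3.
Proof.
  have e1 : (idm (A × B) ×₁ mid B D E) ∘ ⟨⟨a, b⟩, ⟨⟨b, d⟩, e⟩⟩ = ⟨⟨a, b⟩, ⟨b, e⟩⟩ by base_eq.
  have e2 : mid (P := P) (A × B) D E ∘ ⟨⟨⟨a, b⟩, d⟩, e⟩ = ⟨⟨a, b⟩, e⟩ by base_eq.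
  have e3 : dup_shift A B D E ∘ ⟨⟨⟨a, b⟩, d⟩, e⟩ = ⟨⟨a, b⟩, ⟨⟨b, d⟩, e⟩⟩ by base_eq.
  have e4 : (idm (A × B) ×₁ dup B D E) ∘ ⟨⟨a, b⟩, ⟨⟨b, d⟩, e⟩⟩
            = ⟨⟨a, b⟩, ⟨⟨b, d⟩, ⟨d, e⟩⟩⟩ by base_eq.
  have e5 : prod_assoc P (A × B) (B × D) (D × E) ∘ ⟨⟨⟨a, b⟩, ⟨b, d⟩⟩, ⟨d, e⟩⟩
            = ⟨⟨a, b⟩, ⟨⟨b, d⟩, ⟨d, e⟩⟩⟩ by base_eq.
  transitivity (push_elt H mid3_base (lift dup3_base
    (fmap (⟨⟨⟨a, b⟩, ⟨b, d⟩⟩, ⟨d, e⟩⟩^*) (bwd (box_assoc M N L))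
     ∘ lift e5 (box_elt2 p (box_elt2 q r)))) ∘ assoc X Y Z); last first.
  { rewrite push_elt_pre lift_pre -comp_assoc; congr (push_elt _ _ (lift _ _)).
    apply: fmap_bwd_eq.
    exact: (box_elt_assoc e5 (fst_pair P _ _) (snd_pair P _ _)). }
  congr (_ ∘ _).
  rewrite /hcomp3_r {1}/hcomp_elt.
  cbn [fwd iso_comp inv bwd fmap_iso].
  rewrite -> !fmap_comp; ra.
  rewrite !push_elt_map lift_post (box_elt_push_r H e1 (fst_pair P _ _) (snd_pair P _ _)).
  rewrite (push_elt_bc _ _ _ e2 _ _ e3) (push_elt_push_tri _ _ _ _ mid3_base) !push_elt_map.
  rewrite lift_post (box_elt_reidx_r e4 _ _ (fst_pair P _ _) (snd_pair P _ _) (dup_base b d e)).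
  by rewrite tri_lift (lift_sq _ e3 e4 dup3_base e5) lift_post.
Qed.

Lemma hcomp_elt_assoc :
  fmap (⟨a, e⟩^*) (hassoc H M N L) ∘ hcomp_elt (hcomp_elt p q) r
  = hcomp_elt p (hcomp_elt q r) ∘ assoc X Y Z.
Proof.
  rewrite /hassoc. cbn [fwd iso_comp inv].
  rewrite -> fmap_comp; rewrite -comp_assoc hcomp_elt_hcomp3_l.
  by apply: fmap_bwd_eq; rewrite comp_assoc hcomp_elt_hcomp3_r.
Qed.

End Associator.

Lemma bang_base {T A : S} (a : T ⟶ A) : π A ∘ a = π T.
Proof. exact: bang_unique. Qed.

Lemma diag_base {T A : S} (a : T ⟶ A) : Δ A ∘ a = ⟨a, a⟩.
Proof. base_eq. Qed.

(** The identity element in [U(a, a)]: [U] is the pushforward of the unit along the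
    diagonal. *)
Definition hunit_elt {T A : S} (a : T ⟶ A) : (munit : fib C T) ⟶ ⟨a, a⟩^* (hunit H A) :=
  push_elt H (diag_base a) (lift (bang_base a) (smf_eps ((π T)^*))).

Lemma hcomp_elt_runit {T A B : S} {a : T ⟶ A} {b : T ⟶ B} {X : fib C T} {M : fib C (A × B)}
    (p : X ⟶ ⟨a, b⟩^* M) :
  fmap (⟨a, b⟩^*) (hrunit H M) ∘ hcomp_elt p (hunit_elt b) = p ∘ runit X.
Proof.
  have e1 : (idm (A × B) ×₁ Δ B) ∘ ⟨⟨a, b⟩, b⟩ = ⟨⟨a, b⟩, ⟨b, b⟩⟩ by base_eq.
  have e2 : dup_r A B ∘ ⟨a, b⟩ = ⟨⟨a, b⟩, b⟩ by base_eq.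
  have e3 : idm (A × B) ∘ ⟨a, b⟩ = ⟨a, b⟩ by exact: comp_idl.
  have e4 : (idm (A × B) ×₁ π B) ∘ ⟨⟨a, b⟩, b⟩ = ⟨⟨a, b⟩, π T⟩ by base_eq.
  have e5 : ((idm (A × B) ×₁ π B) ∘ dup_r A B) ∘ ⟨a, b⟩ = ⟨⟨a, b⟩, π T⟩.
  { by rewrite -comp_assoc e2. }
  rewrite /hrunit /hcomp_elt /hunit_elt.
  cbn [fwd iso_comp inv bwd fmap_iso].
  rewrite -> !fmap_comp; ra.
  rewrite !push_elt_map lift_post (box_elt_push_r H e1 (fst_pair P _ _) (snd_pair P _ _)).
  rewrite (push_elt_bc _ _ _ e2 _ _ e2).
  rewrite (push_elt_push_tri _ _ _ _ e3) push_elt_push_id.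
  rewrite lift_post (box_elt_reidx_r e4 _ _ (fst_pair P _ _) (snd_pair P _ _) (bang_base b)).
  rewrite tri_lift !lift_post box_elt_unit_r -tri_refl (lift_lift e2 e4 erefl e5).
  rewrite -lift_pre.
  rewrite (comp_pre (lift_lift e5 _ (unit_r_dup A B) e3 _)) comp_assoc.
  by rewrite lift_id.
Qed.

Lemma hcomp_elt_lunit {T A B : S} {a : T ⟶ A} {b : T ⟶ B} {X : fib C T} {M : fib C (A × B)}
    (p : X ⟶ ⟨a, b⟩^* M) :
  fmap (⟨a, b⟩^*) (hlunit H M) ∘ hcomp_elt (hunit_elt a) p = p ∘ lunit X.
Proof.
  have e1 : (Δ A ×₁ idm (A × B)) ∘ ⟨a, ⟨a, b⟩⟩ = ⟨⟨a, a⟩, ⟨a, b⟩⟩ by base_eq.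
  have e2 : dup_l A B ∘ ⟨a, b⟩ = ⟨a, ⟨a, b⟩⟩ by base_eq.
  have e3 : idm (A × B) ∘ ⟨a, b⟩ = ⟨a, b⟩ by exact: comp_idl.
  have e4 : (π A ×₁ idm (A × B)) ∘ ⟨a, ⟨a, b⟩⟩ = ⟨π T, ⟨a, b⟩⟩ by base_eq.
  have e5 : ((π A ×₁ idm (A × B)) ∘ dup_l A B) ∘ ⟨a, b⟩ = ⟨π T, ⟨a, b⟩⟩.
  { by rewrite -comp_assoc e2. }
  have e6 : (Δ A ×₁ idm B) ∘ ⟨a, b⟩ = ⟨⟨a, a⟩, b⟩ by base_eq.
  rewrite /hlunit /hcomp_elt /hunit_elt.
  cbn [fwd iso_comp inv bwd fmap_iso].
  rewrite -> !fmap_comp; ra.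
  rewrite !push_elt_map lift_post (box_elt_push_l H e1 (fst_pair P _ _) (snd_pair P _ _)).
  rewrite (push_elt_bc _ _ _ e6 _ _ e2).
  rewrite (push_elt_push_tri _ _ _ _ e3) push_elt_push_id.
  rewrite lift_post (box_elt_reidx_l e4 _ _ (fst_pair P _ _) (snd_pair P _ _) (bang_base a)).
  rewrite tri_lift !lift_post box_elt_unit_l -tri_refl (lift_lift e2 e4 erefl e5).
  rewrite -lift_pre.
  rewrite (comp_pre (lift_lift e5 _ (unit_l_dup A B) e3 _)) comp_assoc.
  by rewrite lift_id.
Qed.

(** The class of a loop: the shadow is the coproduct of the objects [M(a, a)]. *)
Definition shadow_elt {T A : S} {a : T ⟶ A} {X : fib C T} {M : fib C (A × A)}
    (p : X ⟶ ⟨a, a⟩^* M) : X ⟶ (π T)^* (shadow H M) :=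
  push_elt H (bang_base a) (lift (diag_base a) p).

Lemma shadow_elt_pre {T A : S} {a : T ⟶ A} {X X' : fib C T} {M : fib C (A × A)}
    (p : X ⟶ ⟨a, a⟩^* M) (i : X' ⟶ X) : shadow_elt p ∘ i = shadow_elt (p ∘ i).
Proof. by rewrite /shadow_elt push_elt_pre lift_pre. Qed.

Lemma shadow_elt_map {T A : S} {a : T ⟶ A} {X : fib C T} {M N : fib C (A × A)}
    (p : X ⟶ ⟨a, a⟩^* M) (u : M ⟶ N) :
  fmap ((π T)^*) (shadow_map H u) ∘ shadow_elt p = shadow_elt (fmap (⟨a, a⟩^*) u ∘ p).
Proof. by rewrite /shadow_elt /shadow_map push_elt_map lift_post. Qed.

Section Theta.
Context {T A B : S} {a : T ⟶ A} {b : T ⟶ B} {X Y : fib C T}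
  {M : fib C (A × B)} {N : fib C (B × A)} (p : X ⟶ ⟨a, b⟩^* M) (q : Y ⟶ ⟨b, a⟩^* N).

Lemma cyc_base : cyc A B ∘ ⟨a, b⟩ = ⟨⟨a, b⟩, ⟨b, a⟩⟩.
Proof. base_eq. Qed.

Lemma cyc'_base : cyc' A B ∘ ⟨a, b⟩ = ⟨⟨b, a⟩, ⟨a, b⟩⟩.
Proof. base_eq. Qed.

Lemma shadow_elt_l :
  fmap ((π T)^*) (shadow_l H M N) ∘ shadow_elt (hcomp_elt p q)
  = push_elt H (bang_base ⟨a, b⟩) (lift cyc_base (box_elt2 p q)).
Proof.
  have e : ⟨idm (A × B), fst P A B⟩ ∘ ⟨a, b⟩ = ⟨⟨a, b⟩, a⟩ by base_eq.
  rewrite /shadow_l /shadow_elt /hcomp_elt.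
  cbn [fwd iso_comp inv bwd fmap_iso].
  rewrite -> !fmap_comp; ra.
  rewrite push_elt_map (push_elt_bc _ _ _ (fst_pair P a b) _ _ e).
  rewrite (push_elt_push_tri _ _ _ _ (bang_base ⟨a, b⟩)) push_elt_map.
  by rewrite (lift_lift e _ _ cyc_base).
Qed.

Lemma shadow_elt_r :
  fmap ((π T)^*) (shadow_r H M N) ∘ shadow_elt (hcomp_elt q p)
  = push_elt H (bang_base ⟨a, b⟩) (lift cyc'_base (box_elt2 q p)).
Proof.
  have e : ⟨swap (P := P) A B, snd P A B⟩ ∘ ⟨a, b⟩ = ⟨⟨b, a⟩, b⟩ by base_eq.
  rewrite /shadow_r /shadow_elt /hcomp_elt.
  cbn [fwd iso_comp inv bwd fmap_iso].
  rewrite -> !fmap_comp; ra.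
  rewrite push_elt_map (push_elt_bc _ _ _ (snd_pair P a b) _ _ e).
  rewrite (push_elt_push_tri _ _ _ _ (bang_base ⟨a, b⟩)) push_elt_map.
  by rewrite (lift_lift e _ _ cyc'_base).
Qed.

(** Both shadows are identified with one coproduct over [A × B], in which the products
    [p q] and [q p] differ by the symmetry. *)
Lemma shadow_elt_theta :
  fmap ((π T)^*) (theta H M N) ∘ shadow_elt (hcomp_elt p q)
  = shadow_elt (hcomp_elt q p) ∘ braid X Y.
Proof.
  have e : swap (P := P) (A × B) (B × A) ∘ ⟨⟨a, b⟩, ⟨b, a⟩⟩ = ⟨⟨b, a⟩, ⟨a, b⟩⟩ by base_eq.
  rewrite /theta. cbn [fwd iso_comp inv bwd fmap_iso].
  rewrite -> !fmap_comp; ra.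
  rewrite shadow_elt_l; apply: fmap_bwd_eq.
  rewrite comp_assoc shadow_elt_r !push_elt_map lift_post.
  rewrite (box_elt_swap e _ _ (fst_pair P _ _) (snd_pair P _ _)).
  by rewrite -lift_pre (comp_pre (lift_lift cyc_base e _ cyc'_base _)) push_elt_pre.
Qed.

End Theta.

(** Over the terminal object the pushforwards and reindexings in the shadow are along
    isomorphisms, and the identification with the unit object sends the class of the
    identity element to the canonical one. *)
Lemma shadow_elt_hunit_star (T : S) :
  fmap ((π T)^*) (shadow_hunit_star H) ∘ shadow_elt (hunit_elt (π T)) = smf_eps ((π T)^*).
Proof.
  have e : idm ⋆ ∘ π T = π T by exact: bang_unique.
  rewrite /shadow_hunit_star /shadow_star /hunit_star /shadow_elt.
  cbn [fwd iso_comp inv bwd].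
  rewrite -> !fmap_comp; ra.
  rewrite (push_elt_push_eq _ _ _ e) push_elt_push_id.
  rewrite -(lift_eps (bang_base (π T))); congr (_ ∘ _).
  apply: fmap_bwd_eq; exact: over_comp_def.
Qed.

(** Both sides are the composite of the units of the adjunctions for [Δ A] and [π A],
    which are the opcartesian morphisms used in [hunit_elt] and [shadow_elt]. *)
Lemma unit_to_shadow_elt (A : S) : unit_to_shadow H A = shadow_elt (hunit_elt (idm A)).
Proof.
  rewrite /unit_to_shadow /shadow_elt /hunit_elt.
  rewrite (lift_idr (bang_base (idm A))) push_elt_idr.
  rewrite (lift_idr (diag_base (idm A) : Δ A ∘ idm A = Δ A)) push_elt_idr.
  by rewrite -adj_unit_nat -comp_assoc -adj_unit_nat.
Qed.

End Bicategory.

(** * Transferring duals and traces *)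

Section FiberwiseTransfer.
Context {S : Category} {P : FiniteProducts S} {C : IndexedSMC S} (H : HoCoproducts P C).
Local Notation "A × B" := (prod P A B).
Local Notation "⟨ f , g ⟩" := (pair P f g).
Local Notation "⋆" := (star P).
Local Notation π := (bang P).
Local Notation Δ := (diag P).
Local Notation "f ^*" := (reidx C f) (at level 2, left associativity, format "f ^*").
Local Notation "Σ[ f ]" := (push H f) (at level 0, format "Σ[ f ]").
Local Notation "M ⊙ N" := (hcomp H M N) (at level 39, right associativity).
Local Notation "u ⊙₁ v" := (hcomp_map H u v) (at level 39, right associativity).
Local Notation hcomp_elt := (hcomp_elt H).
Local Notation hunit_elt := (hunit_elt H).
Local Notation shadow_elt := (shadow_elt H).

Lemma hcomp_elt_runit_inv {T A B : S} {a : T ⟶ A} {b : T ⟶ B} {X : fib C T}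
    {M : fib C (A × B)} (p : X ⟶ ⟨a, b⟩^* M) :
  fmap (⟨a, b⟩^*) (bwd (hrunit H M)) ∘ p = hcomp_elt p (hunit_elt b) ∘ bwd (runit X).
Proof.
  by apply: fmap_bwd_eq; rewrite comp_assoc hcomp_elt_runit -comp_assoc fwd_bwd comp_idr.
Qed.

Lemma hcomp_elt_lunit_inv {T A B : S} {a : T ⟶ A} {b : T ⟶ B} {X : fib C T}
    {M : fib C (A × B)} (p : X ⟶ ⟨a, b⟩^* M) :
  fmap (⟨a, b⟩^*) (bwd (hlunit H M)) ∘ p = hcomp_elt (hunit_elt a) p ∘ bwd (lunit X).
Proof.
  by apply: fmap_bwd_eq; rewrite comp_assoc hcomp_elt_lunit -comp_assoc fwd_bwd comp_idr.
Qed.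

Lemma hcomp_elt_assoc_inv {T A B D E : S} {a : T ⟶ A} {b : T ⟶ B} {d : T ⟶ D} {e : T ⟶ E}
    {X Y Z : fib C T} {M : fib C (A × B)} {N : fib C (B × D)} {L : fib C (D × E)}
    (p : X ⟶ ⟨a, b⟩^* M) (q : Y ⟶ ⟨b, d⟩^* N) (r : Z ⟶ ⟨d, e⟩^* L) :
  fmap (⟨a, e⟩^*) (bwd (hassoc H M N L)) ∘ hcomp_elt p (hcomp_elt q r)
  = hcomp_elt (hcomp_elt p q) r ∘ bwd (assoc X Y Z).
Proof.
  by apply: fmap_bwd_eq; rewrite comp_assoc hcomp_elt_assoc -comp_assoc fwd_bwd comp_idr.
Qed.

Lemma hcomp_elt_pre_l {T A B D : S} {a : T ⟶ A} {b : T ⟶ B} {d : T ⟶ D} {X Y X' : fib C T}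
    {M : fib C (A × B)} {N : fib C (B × D)} (p : X ⟶ ⟨a, b⟩^* M) (q : Y ⟶ ⟨b, d⟩^* N)
    (i : X' ⟶ X) : hcomp_elt (p ∘ i) q = hcomp_elt p q ∘ (i ⊗₁ idm Y).
Proof. by rewrite hcomp_elt_pre comp_idr. Qed.

Lemma hcomp_elt_pre_r {T A B D : S} {a : T ⟶ A} {b : T ⟶ B} {d : T ⟶ D} {X Y Y' : fib C T}
    {M : fib C (A × B)} {N : fib C (B × D)} (p : X ⟶ ⟨a, b⟩^* M) (q : Y ⟶ ⟨b, d⟩^* N)
    (j : Y' ⟶ Y) : hcomp_elt p (q ∘ j) = hcomp_elt p q ∘ (idm X ⊗₁ j).
Proof. by rewrite hcomp_elt_pre comp_idr. Qed.

Lemma hcomp_elt_map_l {T A B D : S} {a : T ⟶ A} {b : T ⟶ B} {d : T ⟶ D} {X Y : fib C T}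
    {M M' : fib C (A × B)} {N : fib C (B × D)}
    (p : X ⟶ ⟨a, b⟩^* M) (q : Y ⟶ ⟨b, d⟩^* N) (u : M ⟶ M') :
  fmap (⟨a, d⟩^*) (u ⊙₁ idm N) ∘ hcomp_elt p q = hcomp_elt (fmap (⟨a, b⟩^*) u ∘ p) q.
Proof. by rewrite hcomp_elt_map fmap_id comp_idl. Qed.

Lemma hcomp_elt_map_r {T A B D : S} {a : T ⟶ A} {b : T ⟶ B} {d : T ⟶ D} {X Y : fib C T}
    {M : fib C (A × B)} {N N' : fib C (B × D)}
    (p : X ⟶ ⟨a, b⟩^* M) (q : Y ⟶ ⟨b, d⟩^* N) (v : N ⟶ N') :
  fmap (⟨a, d⟩^*) (idm M ⊙₁ v) ∘ hcomp_elt p q = hcomp_elt p (fmap (⟨b, d⟩^*) v ∘ q).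
Proof. by rewrite hcomp_elt_map fmap_id comp_idl. Qed.

(** Here [Mh : A → ⋆] and [Nh : ⋆ → A] are 1-cells with elements [m] and [n] over [A], and
    the 2-cells [ηh] and [εh] restrict to [η] and [ε] on elements. *)
Section Transfer.
Context {A : S} {M N : fib C A} {Mh : fib C (A × ⋆)} {Nh : fib C (⋆ × A)}
  (m : M ⟶ ⟨idm A, π A⟩^* Mh) (n : N ⟶ ⟨π A, idm A⟩^* Nh).
Context {η : munit ⟶ M ⊗ N} {ε : N ⊗ M ⟶ munit}
  {ηh : hunit H A ⟶ Mh ⊙ Nh} {εh : Nh ⊙ Mh ⟶ hunit H ⋆}.
Context (Hη : fmap (⟨idm A, idm A⟩^*) ηh ∘ hunit_elt (idm A) = hcomp_elt m n ∘ η)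
  (Hε : fmap (⟨π A, π A⟩^*) εh ∘ hcomp_elt n m = hunit_elt (π A) ∘ ε).

(** Apply the bicategorical zigzag to the element [m], which the inverse unitor sends to
    the product of the identity element and [m]: the product of [m], [n] and [m] is
    rebracketed, the last two factors are evaluated, and [m] remains. *)
Lemma transfer_triangle_l :
  fmap (⟨idm A, π A⟩^*) (hrunit H Mh ∘ (idm Mh ⊙₁ εh) ∘ hassoc H Mh Nh Mh
     ∘ (ηh ⊙₁ idm Mh) ∘ inv (hlunit H Mh)) ∘ m
  = m ∘ (runit M ∘ (idm M ⊗₁ ε) ∘ assoc M N M ∘ (η ⊗₁ idm M) ∘ inv (lunit M)).
Proof.
  rewrite -> !fmap_comp; ra. cbn [fwd inv].
  rewrite hcomp_elt_lunit_inv.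
  rewrite (comp_pre (hcomp_elt_map_l _ _ _)) Hη hcomp_elt_pre_l -comp_assoc.
  rewrite (comp_sq (hcomp_elt_assoc _ _ _ _)).
  rewrite (comp_pre (hcomp_elt_map_r _ _ _)) Hε hcomp_elt_pre_r -comp_assoc.
  by rewrite (comp_sq (hcomp_elt_runit _ _)).
Qed.

Lemma transfer_triangle_r :
  fmap (⟨π A, idm A⟩^*) (hlunit H Nh ∘ (εh ⊙₁ idm Nh) ∘ inv (hassoc H Nh Mh Nh)
     ∘ (idm Nh ⊙₁ ηh) ∘ inv (hrunit H Nh)) ∘ n
  = n ∘ (lunit N ∘ (ε ⊗₁ idm N) ∘ inv (assoc N M N) ∘ (idm N ⊗₁ η) ∘ inv (runit N)).
Proof.
  rewrite -> !fmap_comp; ra. cbn [fwd inv].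
  rewrite hcomp_elt_runit_inv.
  rewrite (comp_pre (hcomp_elt_map_r _ _ _)) Hη hcomp_elt_pre_r -comp_assoc.
  rewrite (comp_sq (hcomp_elt_assoc_inv _ _ _)).
  rewrite (comp_pre (hcomp_elt_map_l _ _ _)) Hε hcomp_elt_pre_l -comp_assoc.
  by rewrite (comp_sq (hcomp_elt_lunit _ _)).
Qed.

End Transfer.

(** The successive stages of the bicategorical trace send the class of the identity
    element to the classes of products of [m], [n] and identity elements, each
    multiplied by the corresponding stage of the symmetric monoidal trace. *)
Lemma transfer_trace {A : S} {M : fib C A} (D : Dual M) {Mh : fib C (A × ⋆)}
    (Dh : RightDual H Mh)
    (m : M ⟶ ⟨idm A, π A⟩^* Mh) (n : dual D ⟶ ⟨π A, idm A⟩^* (rdual Dh))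
    (Hη : fmap (⟨idm A, idm A⟩^*) (rcoev Dh) ∘ hunit_elt (idm A) = hcomp_elt m n ∘ coev D)
    (Hε : fmap (⟨π A, π A⟩^*) (rev Dh) ∘ hcomp_elt n m = hunit_elt (π A) ∘ ev D)
    (f : M ⟶ M) (fh : Mh ⟶ Mh) (Hf : fmap (⟨idm A, π A⟩^*) fh ∘ m = m ∘ f) :
  fmap ((π A)^*) (shadow_hunit_star H ∘ bicat_endo_trace Dh fh)
    ∘ shadow_elt (hunit_elt (idm A))
  = smf_eps ((π A)^*) ∘ sm_endo_trace D f.
Proof.
  rewrite /bicat_endo_trace /bicat_trace /sm_endo_trace /sm_trace.
  rewrite -> !fmap_comp; ra. cbn [fwd inv].
  rewrite shadow_elt_map hcomp_elt_runit_inv -shadow_elt_pre.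
  rewrite (comp_pre (shadow_elt_map _ _ _)) hcomp_elt_map_r Hη hcomp_elt_pre_r.
  rewrite -shadow_elt_pre -comp_assoc.
  rewrite (comp_pre (shadow_elt_map _ _ _)) hcomp_elt_assoc_inv -shadow_elt_pre -comp_assoc.
  rewrite (comp_pre (shadow_elt_map _ _ _)) hcomp_elt_map_l.
  have -> : fmap (⟨idm A, π A⟩^*) (bwd (hrunit H Mh) ∘ (fh ∘ hlunit H Mh))
              ∘ hcomp_elt (hunit_elt (idm A)) m
            = hcomp_elt m (hunit_elt (π A)) ∘ (bwd (runit M) ∘ (f ∘ lunit M)).
  { rewrite -> !fmap_comp; ra.
    rewrite hcomp_elt_lunit (comp_pre Hf) -comp_assoc.
    by rewrite (comp_pre (hcomp_elt_runit_inv m)) -comp_assoc. }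
  rewrite hcomp_elt_pre_l -shadow_elt_pre -comp_assoc.
  rewrite (comp_sq (shadow_elt_theta _ _ _)).
  rewrite (comp_pre (shadow_elt_map _ _ _)) hcomp_elt_assoc_inv -shadow_elt_pre -comp_assoc.
  rewrite (comp_pre (shadow_elt_map _ _ _)) hcomp_elt_map_l Hε hcomp_elt_pre_l.
  rewrite -shadow_elt_pre -comp_assoc.
  rewrite (comp_pre (shadow_elt_map _ _ _)) hcomp_elt_lunit -shadow_elt_pre -comp_assoc.
  by rewrite (comp_pre (shadow_elt_hunit_star _ _)).
Qed.


(** The coproduct over the terminal object is taken along an isomorphism of the base. *)
Lemma isiso_hcomp_elt_star {T A D : S} {a : T ⟶ A} {d : T ⟶ D} {b : T ⟶ ⋆} {X Y : fib C T}
    {M : fib C (A × ⋆)} {N : fib C (⋆ × D)} (p : X ⟶ ⟨a, b⟩^* M) (q : Y ⟶ ⟨b, d⟩^* N) :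
  IsIso p -> IsIso q -> IsIso (hcomp_elt p q).
Proof.
  move=> i j; apply: isiso_over_comp; last by apply: isiso_lift; apply: isiso_box_elt.
  apply: (isiso_push_unit H (g := ⟨⟨fst P A D, π (A × D)⟩, snd P A D⟩)); base_eq.
Qed.

Lemma isiso_hunit_elt_star {T : S} (a : T ⟶ ⋆) : IsIso (hunit_elt a).
Proof.
  apply: isiso_over_comp; last by apply: isiso_lift; exact: isiso_fwd.
  apply: (isiso_push_unit H (g := fst P ⋆ ⋆)); base_eq.
Qed.

Lemma hunit_elt_idm (A : S) :
  hunit_elt (idm A) = adj_unit Σ[Δ A] ((π A)^* munit) ∘ smf_eps ((π A)^*).
Proof.
  by rewrite /hunit_elt (lift_idr (bang_base (idm A))) push_elt_idr.
Qed.

Section FiberwiseDuals.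
Context {A : S} (M : fib C A).

Lemma hat_base : fst P A ⋆ ∘ ⟨idm A, π A⟩ = idm A.
Proof. base_eq. Qed.

Lemma cohat_base : snd P ⋆ A ∘ ⟨π A, idm A⟩ = idm A.
Proof. base_eq. Qed.

Lemma hat_base_inv : ⟨idm A, π A⟩ ∘ fst P A ⋆ = idm _.
Proof. base_eq. Qed.

Lemma cohat_base_inv : ⟨π A, idm A⟩ ∘ snd P ⋆ A = idm _.
Proof. base_eq. Qed.

Definition hat_elt : Iso M (⟨idm A, π A⟩^* (hat (P := P) M)) :=
  inv (reidx_inverse hat_base M).

Lemma hat_elt_map (f : M ⟶ M) :
  fmap (⟨idm A, π A⟩^*) (hat_map f) ∘ hat_elt = hat_elt ∘ f.
Proof.
  symmetry; apply: (inv_nat (i := reidx_inverse hat_base M) (j := reidx_inverse hat_base M)).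
  by rewrite reidx_inverse_nat.
Qed.

(** The coevaluation is defined by its value on the identity element, the evaluation by its
    value on the product [n m], which determines it since that product is taken at the
    base point [⟨⟨π A, idm A⟩, π A⟩], an isomorphism from [A] to [(⋆ × A) × ⋆]. *)
Lemma hat_right_dualizable (D : Dual M) : inhabited (RightDual H (hat (P := P) M)).
Proof.
  pose n : Iso (dual D) (⟨π A, idm A⟩^* ((snd P ⋆ A)^* (dual D))) :=
    inv (reidx_inverse cohat_base (dual D)).
  pose ηh : hunit H A ⟶ hat M ⊙ (snd P ⋆ A)^* (dual D) :=
    transpose Σ[Δ A] ((hcomp_elt hat_elt n ∘ coev D) ∘ bwd (smf_eps ((π A)^*))).
  have Hη : fmap (⟨idm A, idm A⟩^*) ηh ∘ hunit_elt (idm A) = hcomp_elt hat_elt n ∘ coev D.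
  { rewrite hunit_elt_idm comp_assoc [X in X ∘ _](transpose_unit Σ[Δ A]).
    by rewrite -comp_assoc bwd_fwd comp_idr. }
  have [w Hw] := over_extend (s := ⟨⟨π A, idm A⟩, π A⟩) (k := snd P ⋆ A ∘ fst P _ ⋆)
    (h := mid ⋆ A ⋆) ltac:(base_eq) ltac:(base_eq) (mid_base (π A) (idm A) (π A))
    (hunit_elt (π A) ∘ ev D)
    (isiso_lift (dup_base _ _ _)
      (isiso_box_elt (fst_pair P _ _) (snd_pair P _ _) (isiso_fwd n) (isiso_fwd hat_elt))).
  have Hε : fmap (⟨π A, π A⟩^*) (transpose Σ[mid ⋆ A ⋆] w) ∘ hcomp_elt n hat_elt
            = hunit_elt (π A) ∘ ev D.
  { by rewrite /hcomp_elt /push_elt over_comp_post transpose_unit. }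
  constructor.
  refine {| rdual := (snd P ⋆ A)^* (dual D); rcoev := ηh;
            rev := transpose Σ[mid ⋆ A ⋆] w |}.
  - apply/(transfer_idm hat_base_inv (transfer_triangle_l Hη Hε)).
    exact: dual_triangle_l.
  - apply/(transfer_idm cohat_base_inv (transfer_triangle_r Hη Hε)).
    exact: dual_triangle_r.
Qed.

(** The coevaluation and evaluation in the fibre exist because products over [⋆] and the
    identity element over [⋆] are invertible. *)
Lemma dual_of_hat_dual (Dh : RightDual H (hat (P := P) M)) :
  exists (D : Dual M) (n : dual D ⟶ ⟨π A, idm A⟩^* (rdual Dh)),
    fmap (⟨idm A, idm A⟩^*) (rcoev Dh) ∘ hunit_elt (idm A) = hcomp_elt hat_elt n ∘ coev D
    /\ fmap (⟨π A, π A⟩^*) (rev Dh) ∘ hcomp_elt n hat_elt = hunit_elt (π A) ∘ ev D.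
Proof.
  pose n := iso_id (⟨π A, idm A⟩^* (rdual Dh)).
  pose i := iso_of (isiso_hcomp_elt_star (isiso_fwd hat_elt) (isiso_fwd n)).
  pose j := iso_of (isiso_hunit_elt_star (π A)).
  pose η := bwd i ∘ (fmap (⟨idm A, idm A⟩^*) (rcoev Dh) ∘ hunit_elt (idm A)).
  pose ε := bwd j ∘ (fmap (⟨π A, π A⟩^*) (rev Dh) ∘ hcomp_elt n hat_elt).
  have Hη : fmap (⟨idm A, idm A⟩^*) (rcoev Dh) ∘ hunit_elt (idm A) = hcomp_elt hat_elt n ∘ η.
  { symmetry; exact: (fwd_bwd_comp i). }
  have Hε : fmap (⟨π A, π A⟩^*) (rev Dh) ∘ hcomp_elt n hat_elt = hunit_elt (π A) ∘ ε.
  { symmetry; exact: (fwd_bwd_comp j). }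
  have T1 := proj1 (transfer_idm hat_base_inv (transfer_triangle_l Hη Hε))
               (rdual_triangle_l Dh).
  have T2 := proj1 (transfer_idm cohat_base_inv (transfer_triangle_r Hη Hε))
               (rdual_triangle_r Dh).
  by exists {| dual_triangle_l := T1; dual_triangle_r := T2 |}, n.
Qed.

End FiberwiseDuals.

End FiberwiseTransfer.

Theorem theorem1p1 (S : Category) (P : FiniteProducts S) (C : IndexedSMC S)
    (H : HoCoproducts P C) (A : S) (M : fib C A) (D : Dual M) (f : M ⟶ M) :
  inhabited (RightDual H (hat (P := P) M)) /\
  forall D' : RightDual H (hat (P := P) M),
    sm_endo_trace D f
    = inv (smf_eps (reidx C (bang P A)))
      ∘ fmap (reidx C (bang P A)) (hat_trace D' f)
      ∘ unit_to_shadow H A.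
Proof.
  split; first exact: hat_right_dualizable D.
  move=> D'; have [D2 [n [Hη Hε]]] := dual_of_hat_dual D'.
  rewrite (sm_endo_trace_unique D D2) unit_to_shadow_elt -comp_assoc.
  by rewrite /hat_trace (transfer_trace Hη Hε (hat_elt_map f)) bwd_fwd_comp.
Qed.
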